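(* Let $d\ge 3$. For any $u>0$ and $0<T_1<T_2<\infty$ such that $T_1T_2\le 1$, the finitary random interlacement $\mathcal{FI}^{u,T_2}$ on $\mathbb{Z}^d$ stochastically dominates $\mathcal{FI}^{u,T_1}$; that is, there is a coupling of $\mathcal{FI}^{u,T_1}$ and $\mathcal{FI}^{u,T_2}$ such that almost surely, for every edge $e\in\mathbb{L}^d$, $\mathcal{FI}^{u,T_1}(e)\le \mathcal{FI}^{u,T_2}(e)$.
   Context: $\mathbb{L}^d=\{\{x,y\}: x,y\in\mathbb{Z}^d,\ |x-y|_2=1\}$ is the set of undirected nearest-neighbor edges of $\mathbb{Z}^d$ ($|\cdot|_2$ is the Euclidean norm). For $T\in(0,\infty)$ and $x\in\mathbb{Z}^d$, $P_x^{(T)}$ is the law of the simple random walk on $\mathbb{Z}^d$ started at $x$ and killed with probability $\frac1{T+1}$ at each step: the number of steps $N$ (the length of the path) satisfies $P(N=k)=\left(\frac{T}{T+1}\right)^k\frac{1}{T+1}$ for $k=0,1,2,\dots$ (mean $T$) and is independent of the underlying simple random walk. $P_x^{(T)}$ is regarded as a measure on the set $W^{[0,\infty)}$ of finite nearest-neighbor paths in $\mathbb{Z}^d$. For $0<u,T<\infty$, the finitary random interlacement $\mathcal{FI}^{u,T}$ is the Poisson point process on $W^{[0,\infty)}$ with intensity measure $u\sum_{x\in\mathbb{Z}^d}\frac{2d}{T+1}P_x^{(T)}$. Equivalently, with $\{N_x\}_{x\in\mathbb{Z}^d}$ i.i.d. Poisson of parameter $\frac{2du}{T+1}$, one starts $N_x$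 independent killed walks of law $P_x^{(T)}$ from each $x\in\mathbb{Z}^d$, and $\mathcal{FI}^{u,T}$ is the point measure consisting of all these trajectories. It is also regarded as a bond percolation model: an edge $e\in\mathbb{L}^d$ is open, written $\mathcal{FI}^{u,T}(e)=1$, iff some path in $\mathcal{FI}^{u,T}$ traverses $e$; otherwise $\mathcal{FI}^{u,T}(e)=0$. The coupling in the claim concerns the edge configurations $(\mathcal{FI}^{u,T_i}(e))_{e\in\mathbb{L}^d}$, $i=1,2$. *)

(* Defs.v *)
From HB Require Import structures.
From mathcomp Require Import all_boot all_order all_algebra.
From mathcomp Require Import finmap.
From mathcomp Require Import all_classical all_reals all_analysis.
From mathcomp Require Import measurable_realfun.

Set Implicit Arguments.
Unset Strict Implicit.
Unset Printing Implicit Defensive.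

Import Order.TTheory GRing.Theory Num.Theory.

Local Open Scope classical_set_scope.
Local Open Scope ring_scope.

Notation lattice d := 'rV[int]_d.

(* |x - y|_2 = 1, squared on both sides so as to stay in the integers. *)
Definition nearest_neighbor (d : nat) : rel (lattice d) :=
  fun x y => \sum_(i < d) (x ord0 i - y ord0 i) ^+ 2 == 1.

Definition lattice_edges (d : nat) : set {fset lattice d} :=
  [set e | exists x y, nearest_neighbor x y /\ e = [fset x; y]%fset].
Arguments lattice_edges : clear implicits.

(* The path (x_0, ..., x_k) is encoded as the pair (x_0, [:: x_1; ...; x_k]). *)
Definition walk (d : nat) : Type :=
  {w : lattice d * seq (lattice d) | path (@nearest_neighbor d) w.1 w.2}.

Definition walk_start (d : nat) (w : walk d) : lattice d := (val w).1.

Definition walk_length (d : nat) (w : walk d) : nat := size (val w).2.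

Definition walk_edges (d : nat) (w : walk d) : seq {fset lattice d} :=
  pairmap (fun x y => [fset x; y]%fset) (val w).1 (val w).2.

(* [walk d] is countable and carries the discrete sigma-algebra, so the laws  *)
(* below are defined on all of its subsets.                                   *)

(* Law of the first k steps of the simple random walk started at x: each step *)
(* goes to one of the 2d neighbors of the current site with probability       *)
(* 1/(2d).                                                                    *)
Definition srw_law (R : realType) (d : nat) (x : lattice d) (k : nat)
    (A : set (walk d)) : \bar R :=
  \esum_(w in A `&` [set w | walk_start w = x /\ walk_length w = k])
    (((2 * d)%:R^-1 ^+ k : R)%:E).

(* P_x^(T): the number of steps is geometric, independent of the walk. *)
Definition killed_walk_law (R : realType) (d : nat) (T : R) (x : lattice d)
    (A : set (walk d)) : \bar R :=
  (\sum_(0 <= k <oo)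
     ((T / (T + 1)) ^+ k * (T + 1)^-1)%:E * srw_law R x k A)%E.

Definition FI_intensity (R : realType) (d : nat) (u T : R)
    (A : set (walk d)) : \bar R :=
  (u%:E * \esum_(x in [set: lattice d])
            (((2 * d)%:R / (T + 1))%:E * killed_walk_law T x A))%E.

(* Taking some of the B i to be the whole space gives the product rule for    *)
(* subfamilies.                                                               *)
Definition mutually_independent (dO : measure_display) (O : measurableType dO)
    (R : realType) (P : probability O R) (dE : measure_display)
    (E : measurableType dE) (n : nat) (Y : 'I_n -> O -> E) : Prop :=
  forall B : 'I_n -> set E, (forall i, measurable (B i)) ->
    P (\bigcap_i (Y i @^-1` B i)) = (\prod_(i < n) P (Y i @^-1` B i))%E.

(* Mass of A under the point measure giving multiplicity [m w] to [w]. *)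
Definition point_count (R : realType) (E : choiceType) (m : E -> nat)
    (A : set E) : \bar R :=
  \esum_(w in A) ((m w)%:R : R)%:E.

(* Poisson point process of intensity mu on a countable discrete space E; X o *)
(* gives the multiplicities of the points. (The second argument of            *)
(* [poisson_prob] is a dummy, and [poisson_prob 0] is the Dirac mass at 0.)   *)
Definition Poisson_point_process (dO : measure_display)
    (O : measurableType dO) (R : realType) (P : probability O R)
    (E : countType) (mu : set E -> \bar R) (X : O -> E -> nat) : Prop :=
  [/\ forall w : E, measurable_fun [set: O] (fun o => X o w),
      forall A : set E, (mu A < +oo)%E -> forall k : nat,
        P [set o | point_count R (X o) A = (k%:R)%:E]
        = poisson_prob (fine (mu A)) 0 [set k],
      forall A : set E, mu A = +oo%E ->
        P [set o | point_count R (X o) A = +oo%E] = 1%E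
    & forall (n : nat) (A : 'I_n -> set E), trivIset [set: 'I_n] A ->
        mutually_independent P (fun i o => point_count R (X o) (A i))].

(* Edge configurations, [true] meaning open, with the product sigma-algebra. *)
Definition open_events (d : nat) : set (set (lattice_edges d -> bool)) :=
  [set [set eta : lattice_edges d -> bool | eta e]
     | e in [set: lattice_edges d]].

Notation config d := (g_sigma_algebraType (@open_events d)).

Definition open_edges (d : nat) (m : walk d -> nat) : config d :=
  fun e => `[< exists w, (0 < m w)%N /\ val e \in walk_edges w >].

(* nu is the law of the edge configuration of FI^{u,T}, i.e. the image of a   *)
(* Poisson point process of intensity [FI_intensity u T] under [open_edges];  *)
(* the law of such a process is determined by its intensity, so the choice of *)
(* the underlying probability space is immaterial.                            *)
Definition FI_law (R : realType) (d : nat) (u T : R)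
    (nu : set (config d) -> \bar R) : Prop :=
  exists (dO : measure_display) (O : measurableType dO) (P : probability O R)
         (X : O -> walk d -> nat),
    Poisson_point_process P (FI_intensity u T) X /\
    forall A : set (config d), measurable A ->
      nu A = P [set o | A (open_edges (X o))].

(* Main.v *)
Require Import Defs.
From HB Require Import structures.
From mathcomp Require Import all_boot all_order all_algebra.
From mathcomp Require Import finmap.
From mathcomp Require Import all_classical all_reals all_analysis.
From mathcomp Require Import measurable_realfun.
From mathcomp Require Import ring lra zify.

Set Implicit Arguments.
Unset Strict Implicit.
Unset Printing Implicit Defensive.

Import Order.TTheory GRing.Theory Num.Theory.
Import numFieldNormedType.Exports.

Local Open Scope classical_set_scope.
Local Open Scope ring_scope.

(** Only the trajectories with at least one step open edges. Put
    [p = T / (T + 1)]. In [FI^{u,T}] the walks with at least one step start from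
    each site at rate [2d u p (1 - p) = 2d u T / (T + 1)^2], and their length
    minus one is geometric of parameter [p]. If [T1 < T2] and [T1 * T2 <= 1],
    both the rate and the length increase stochastically from [T1] to [T2]: the
    rate because
    [T2 (T1 + 1)^2 - T1 (T2 + 1)^2 = (T2 - T1) (1 - T1 T2) >= 0]. So a subfamily
    of the walks at [T2], cut at suitable lengths, is distributed as the family
    of nontrivial walks at [T1].

    This is realized by a single Poisson point process on triples [(x, s, v)],
    standing for the walk [s ++ v] started at [x] together with its prefix [s],
    and on sites [x], standing for trivial walks. The second family of walks
    consists of the [s ++ v], the first one of the nonempty [s] and of the
    trivial walks; an empty [s] stands for a walk without counterpart in the
    first family. The weight of [(x, s, v)] is [(2d)^-(|s| + |v|)] times an
    explicit function of [|s|] and [|v|] ([split_weight]); its sum over the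
    prefixes of a walk ([sum_split_weight_long]) gives the intensity at [T2] and
    its sum over the extensions of a nonempty walk ([sum_split_weight_short])
    gives the intensity at [T1]. Both families are then Poisson by the mapping
    theorem ([Poisson_point_process_map]), and the domination holds because a
    walk crosses all the edges of its prefixes ([open_edges_dominated]).

    The Poisson process itself ([exists_Poisson_point_process]) is built from a
    sequence of independent Poisson variables carried by a uniform variable on
    the unit interval. When only finitely many indices are taken into account,
    the counts of disjoint sets are independent Poisson variables, by induction
    on the number of indices; the joint law of the full counts follows by a
    limit, and total probability turns it into mutual independence. *)

(** * A sequence of independent variables on the unit interval *)

Section IndependentSequence.
Variables (R : realType) (p : nat -> nat -> R).
Hypothesis p_ge0 : forall n k, 0 <= p n k.
Hypothesis p_sum1 : forall n, series (p n) @ \oo --> (1 : R).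

(** [cumul n k] is the probability that the [n]-th variable is less than [k]. *)
Let cumul n k : R := \sum_(0 <= i < k) p n i.

Let cumul_le n : {homo cumul n : i j / (i <= j)%N >-> i <= j}.
Proof.
move=> i j ij; rewrite /cumul (big_cat_nat (leq0n i) ij)/= lerDl.
by apply: sumr_ge0.
Qed.

Let cumulS n k : cumul n k.+1 = cumul n k + p n k.
Proof. by rewrite /cumul big_nat_recr. Qed.

Let cumul0 n : cumul n 0 = 0. Proof. by rewrite /cumul big_geq. Qed.

Let cumul_ge0 n k : 0 <= cumul n k.
Proof. by rewrite -(cumul0 n); exact: cumul_le. Qed.

Let cumul_le1 n k : cumul n k <= 1.
Proof.
rewrite -(cvg_lim _ (p_sum1 n))//; apply: nondecreasing_cvgn_le.
  by move=> i j; exact: cumul_le.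
by apply/cvg_ex; exists 1; exact: p_sum1.
Qed.

(** The [n]-th variable as a quantile function; it is 0 unless
    [0 <= v < 1]. *)
Let digit n (v : R) : nat :=
  if 0 <= v < 1 then xget 0 [set k | cumul n k <= v < cumul n k.+1] else 0.

Let digitP n v k : 0 <= v < 1 ->
  (digit n v = k <-> cumul n k <= v < cumul n k.+1).
Proof.
move=> v01; rewrite /digit v01; split => [<-|kv].
  suff [j jv] : exists j, cumul n j <= v < cumul n j.+1.
    by case: xgetP => //= /(_ j).
  have exj : exists j, v < cumul n j.
    have /andP[_ v1] := v01.
    have [N _ NP] : \forall j \near \oo, v < series (p n) j.
      by have /cvgr_gt := p_sum1 n; apply.
    by exists N; apply: NP => /=.
  case: (ex_minnP exj) => -[|j] vj minj.
    by move: vj; rewrite cumul0 ltNge; case/andP: v01 => ->.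
  exists j; rewrite vj andbT leNgt; apply/negP => /minj.
  by rewrite ltnn.
case: xgetP => [j _ /= /andP[jv vj]|/(_ k)]; last by rewrite /= kv.
case/andP: kv => kv vk.
apply/eqP; rewrite eqn_leq; apply/andP; split; rewrite leqNgt; apply/negP.
  by move=> /(cumul_le n) /(lt_le_trans vk) /lt_le_trans /(_ jv); rewrite ltxx.
by move=> /(cumul_le n) /(lt_le_trans vj) /lt_le_trans /(_ kv); rewrite ltxx.
Qed.

Let measurable_digit n : measurable_fun setT (digit n).
Proof.
move=> _ Y _; rewrite setTI.
have -> : digit n @^-1` Y = \bigcup_k
  (if k \in Y then digit n @^-1` [set k] else set0).
  apply/seteqP; split => [v Yv|v [k _]].
    by exists (digit n v) => //; rewrite mem_set.
  by case: ifPn => // /set_mem kY /= ->.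
apply: bigcupT_measurable => k; case: ifPn => // _.
have -> : digit n @^-1` [set k] = `[0, 1[%classic `&`
   `[cumul n k, cumul n k.+1[%classic `|`
   (if k == 0 then ~` `[0, 1[%classic else set0) :> set R.
  apply/seteqP; split => v /=.
    rewrite !in_itv /=; have [v01|v01] := boolP (0 <= v < 1).
      by move=> /digitP -/(_ v01) ?; left.
    by rewrite /digit (negPf v01) => <-; right; rewrite /= in_itv/=; apply/negP.
  rewrite !in_itv /= => -[[v01 vk]|]; first exact/digitP.
  case: eqP => // -> /negP; rewrite in_itv /= => v01.
  by rewrite /digit (negPf v01).
apply: measurableU; first exact: measurableI.
by case: ifP => // _; exact: measurableC.
Qed.

(** The relative position of [v] in the interval selected by [digit n v]: it is
    again uniform, and independent of the digit. *)
Let rest n (v : R) : R := (v - cumul n (digit n v)) / p n (digit n v).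

Let measurable_rest n : measurable_fun setT (rest n).
Proof.
apply: measurable_funM; first apply: measurable_funB => //.
- by apply: (@measurableT_comp _ _ _ _ _ _ (cumul n)).
- by apply: (@measurableT_comp _ _ _ _ _ _ (fun k => (p n k)^-1)).
Qed.

(** The uniform variable left after reading the first [n] digits of [u]. *)
Let unif := fix unif n (u : R) : R :=
  if n is m.+1 then rest m (unif m u) else u.

Let measurable_unif n : measurable_fun setT (unif n).
Proof.
elim: n => [|n IH]; first exact: measurable_id.
exact: (measurableT_comp (measurable_rest n)).
Qed.

Let draw (u : R) n : nat := digit n (unif n u).

Let measurable_draw n : measurable_fun setT (draw ^~ n).
Proof. exact: (measurableT_comp (measurable_digit n)). Qed.

(** The first [n] variables take prescribed values exactly on a half-open
    interval, on which [unif n] is the increasing affine map onto the interval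
    from 0 to 1. *)
Let draw_cylinder n (s : nat -> nat) :
  exists a : R, let l := \prod_(i < n) p i (s i) in
  [/\ 0 <= a, a + l <= 1,
    (forall u, 0 <= u < 1 /\ (forall i, (i < n)%N -> draw u i = s i) <->
        a <= u < a + l) &
    (forall u, a <= u < a + l -> unif n u = (u - a) / l)].
Proof.
elim: n => [|n [a [a0 al1 cyl cylu]]].
  exists 0; rewrite big_ord0; split => //=; rewrite ?add0r//.
  - by move=> u; split => [[]|].
  - by move=> u _; rewrite subr0 divr1.
set l := \prod_(i < n) p i (s i) in al1 cyl cylu.
have l_ge0 : 0 <= l by apply: prodr_ge0.
set k := s n.
(* the interval [a, a + l) is subdivided proportionally to the [n]-th law *)
have aF_le u : a + l * cumul n k <= u -> a <= u.
  by apply: le_trans; rewrite lerDl mulr_ge0.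
have aF_lt u : u < a + l * cumul n k.+1 -> u < a + l.
  move=> /lt_le_trans; apply; rewrite lerD2l.
  by rewrite -[leRHS]mulr1 ler_wpM2l.
exists (a + l * cumul n k); rewrite big_ord_recr /= -/l -/k.
have E : a + l * cumul n k + l * p n k = a + l * cumul n k.+1.
  by rewrite cumulS mulrDr addrA.
have key u : a <= u < a + l ->
   (draw u n = k <-> a + l * cumul n k <= u < a + l * cumul n k.+1).
  move=> ual.
  have l_gt0 : 0 < l by have /andP[/le_lt_trans h /h] := ual; rewrite ltrDl.
  rewrite /draw (cylu u ual) digitP; last first.
    rewrite divr_ge0 ?subr_ge0 ?(andP ual).1//=.
    by rewrite ltr_pdivrMr// mul1r ltrBlDl (andP ual).2.
  by rewrite ler_pdivlMr// ltr_pdivrMr// lerBrDl ltrBlDl !(mulrC _ l).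
split.
- by rewrite addr_ge0// mulr_ge0.
- rewrite E; apply: le_trans al1; rewrite lerD2l.
  by rewrite -[leRHS]mulr1 ler_wpM2l.
- move=> u; rewrite E; split => [[u01 ds]|uF].
    have ual : a <= u < a + l by apply/cyl; split => // i /ltnW; exact: ds.
    by apply/key => //; exact: ds.
  have ual : a <= u < a + l.
    by case/andP: uF => /aF_le -> /aF_lt ->.
  have /cyl[u01 ds] := ual; split => // i; rewrite ltnS leq_eqVlt.
  by case/orP => [/eqP ->|/ds //]; exact/key.
- move=> u; rewrite E => uF.
  have ual : a <= u < a + l.
    by case/andP: uF => /aF_le -> /aF_lt ->.
  have l_gt0 : 0 < l by have /andP[/le_lt_trans h /h] := ual; rewrite ltrDl.
  have pk_gt0 : 0 < p n k.
    rewrite lt_neqAle p_ge0 andbT; apply/eqP => pk0.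
    by move: uF => /andP[/le_lt_trans h /h]; rewrite cumulS -pk0 addr0 ltxx.
  have dk : digit n (unif n u) = k by apply/key.
  rewrite /= /rest dk (cylu u ual); field.
  by rewrite !gt_eqF.
Qed.

(** There are independent variables with prescribed laws on the naturals.
    Independence is expressed by the cylinder probabilities. *)
Lemma independent_nat_sequence :
  exists (dO : measure_display) (O : measurableType dO) (P : probability O R)
    (M : O -> nat -> nat), (forall n, measurable_fun setT (M ^~ n)) /\
  forall n (s : nat -> nat),
    P [set u | forall i, (i < n)%N -> M u i = s i] =
    (\prod_(i < n) p i (s i))%:E.
Proof.
pose P : probability (measurableTypeR R) R := uniform_prob (@ltr01 R).
refine (ex_intro _ _ (ex_intro _ _ (ex_intro _ P (ex_intro _ draw _)))); split.
  exact: measurable_draw.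
move=> n s; have [a] := draw_cylinder n s; move=> [a0 al1 cyl _].
set l := \prod_(i < n) _ in al1 cyl *.
have l_ge0 : 0 <= l by apply: prodr_ge0.
set S := [set u | _].
have mS : @measurable _ (measurableTypeR R) S.
  have -> : S = \bigcap_i (draw ^~ i @^-1` [set k | (i < n)%N -> k = s i]).
    by apply/seteqP; split => u /= H i => [_ /H//|/(H i I)].
  apply: bigcapT_measurable => i.
  rewrite -[X in measurable X]setTI.
  exact: measurable_draw.
rewrite /uniform_prob.
(* the density is 1 on the closed interval, whose right end point is null *)
transitivity (\int[lebesgue_measure]_(x in S)
    (\1_(`[0%R, 1%R]%classic : set R) x)%:E)%E.
  apply: eq_integral => x _; rewrite indicE /uniform_pdf subr0 invr1.
  rewrite mem_setE in_itv/=; case: ifPn => //.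
rewrite integral_indic//.
transitivity (lebesgue_measure (`[a, a + l[%classic : set R)); last first.
  rewrite lebesgue_measure_itv /= lte_fin; case: ifPn => [_|].
    by rewrite -EFinB addrC addKr.
  by rewrite -leNgt gerDl => l0; congr EFin; apply/eqP; rewrite eq_le l0 l_ge0.
apply/eqP; rewrite eq_le; apply/andP; split; last first.
  apply: le_measure; rewrite ?inE//=; first exact: measurableI.
  move=> u /=; rewrite in_itv/= => /cyl[/andP[u0 u1] Su].
  by split => //=; rewrite in_itv/= u0 ltW.
have -> : lebesgue_measure (`[a, a + l[%classic : set R) =
   lebesgue_measure (`[a, a + l[%classic `|` [set 1] : set R).
  by apply/esym; apply: measureU0 => //; exact: lebesgue_measure_set1.
apply: le_measure; rewrite ?inE//=; first exact: measurableI.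
  exact: measurableU.
move=> u [/=]; rewrite in_itv/= => /andP[u0 u1] Su.
have [->|un1] := eqVneq u 1; first by right.
by left; rewrite /= in_itv/=; apply/cyl; split => //; rewrite u0 lt_neqAle un1.
Qed.
End IndependentSequence.

(** * Poisson weights *)

(** Mass at [k] of the Poisson law of parameter [r >= 0]; for [r = 0] it is the
    Dirac mass at 0. *)
Definition poisson_mass (R : realType) (r : R) (k : nat) : R :=
  r ^+ k * k`!%:R^-1 * expR (- r).

Lemma poisson_mass_ge0 (R : realType) (r : R) k :
  0 <= r -> 0 <= poisson_mass r k.
Proof. by move=> r0; rewrite !mulr_ge0 ?exprn_ge0 ?expR_ge0. Qed.

Lemma poisson_prob_set1 (R : realType) (r : R) i k : 0 <= r ->
  poisson_prob r i [set k] = (poisson_mass r k)%:E.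
Proof.
rewrite le_eqVlt /poisson_prob => /predU1P[<-|r0].
  rewrite ltxx diracE /poisson_mass oppr0 expR0 mulr1.
  case: k => [|k]; first by rewrite mem_set// expr0 fact0 mul1r invr1.
  by rewrite memNset//= expr0n mul0r.
by rewrite r0 esum_set1 ?lee_fin ?poisson_pmf_ge0// /poisson_pmf r0.
Qed.

Lemma poisson_mass_sum (R : realType) (r : R) : 0 <= r ->
  series (poisson_mass r) @ \oo --> (1 : R).
Proof.
move=> r0; have -> : series (poisson_mass r) =
    (fun n => expR (- r) * series (exp_coeff r) n).
  apply/funext => n; rewrite /series/= big_distrr; apply: eq_bigr => i _ /=.
  by rewrite /poisson_mass /exp_coeff mulrC.
rewrite -[X in _ --> X](mulVf (lt0r_neq0 (expR_gt0 r))) -expRN.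
by apply: cvgMr; rewrite /expR; exact: is_cvg_series_exp_coeff.
Qed.

Lemma poisson_mass_sumE (R : realType) (r : R) : 0 <= r ->
  (\sum_(k <oo) (poisson_mass r k)%:E = 1)%E.
Proof.
move=> r0; apply/cvg_lim => //.
under eq_fun do rewrite sumEFin.
by apply/fine_cvgP; split; [exact: nearW|exact: poisson_mass_sum].
Qed.

Lemma poisson_mass0 (R : realType) k : poisson_mass 0 k = (k == 0%N)%:R :> R.
Proof.
rewrite /poisson_mass oppr0 expR0 mulr1 expr0n; case: k => [|k]/=.
  by rewrite fact0 invr1 mul1r.
by rewrite mul0r.
Qed.

Lemma poisson_mass_conv (R : realType) (a b : R) k :
  \sum_(c < k.+1) poisson_mass a (k - c) * poisson_mass b c =
  poisson_mass (a + b) k.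
Proof.
rewrite /poisson_mass opprD expRD exprDn 2!mulr_suml.
apply: eq_bigr => -[c ck] _ /=.
rewrite ltnS in ck; have := bin_fact ck => /(congr1 (fun x => x%:R : R)).
rewrite !natrM => <-.
have f0 m : (m`!%:R : R) != 0 by rewrite pnatr_eq0 -lt0n fact_gt0.
have c0 : ('C(k, c)%:R : R) != 0 by rewrite pnatr_eq0 -lt0n bin_gt0.
rewrite -mulr_natr; field.
by rewrite c0 !f0.
Qed.

Lemma poisson_mass_cvg0 (R : realType) k :
  poisson_mass r k @[r --> +oo] --> (0 : R).
Proof.
apply: (@squeeze_cvgr _ _ _ _ (fun=> 0) (fun r => k.+1%:R * r^-1)).
- near=> r.
  have r0 : 0 < r by near: r; exact: nbhs_pinfty_gt.
  rewrite (poisson_mass_ge0 k (ltW r0))/= ler_pdivlMr//.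
  (* the (k+1)-st mass is at most 1 *)
  have : poisson_mass r k.+1 <= 1.
    rewrite -(cvg_lim _ (poisson_mass_sum (ltW r0)))//.
    have nd : {homo series (poisson_mass r) : i j / (i <= j)%N >-> i <= j}.
      move=> i j ij; rewrite /series /= (big_cat_nat (leq0n i) ij)//= lerDl.
      by apply: sumr_ge0 => l _; exact/poisson_mass_ge0/ltW.
    have cv : cvgn (series (poisson_mass r)).
      by apply/cvg_ex; exists 1; exact/poisson_mass_sum/ltW.
    apply: le_trans (nondecreasing_cvgn_le nd cv k.+2).
    rewrite /series /= big_nat_recr//= lerDr.
    by apply: sumr_ge0 => l _; exact/poisson_mass_ge0/ltW.
  have -> : poisson_mass r k.+1 = poisson_mass r k * r / k.+1%:R.
    rewrite /poisson_mass factS natrM exprS; field.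
    by rewrite addrC natr1 !pnatr_eq0 -!lt0n fact_gt0.
  by rewrite ler_pdivrMr ?mul1r.
- exact: cvg_cst.
- rewrite -[X in _ --> X](mulr0 k.+1%:R); apply: cvgMr.
  apply/gtr0_cvgV0; last exact: cvg_id.
  exact: nbhs_pinfty_gt.
Unshelve. all: by end_near. Qed.

Lemma continuous_poisson_mass (R : realType) k :
  continuous (fun r : R => poisson_mass r k).
Proof.
move=> r; apply: cvgM; first apply: cvgM.
- exact: exprn_continuous.
- exact: cvg_cst.
- by apply: continuous_comp; [exact: opp_continuous|exact: continuous_expR].
Qed.

(** * Partial counts *)

Section NextVariable.
Context (R : realType) (dO : measure_display) (O : measurableType dO).
Variables (P : probability O R) (M : O -> nat -> nat) (p : nat -> nat -> R).
Hypothesis mM : forall n, measurable_fun setT (M ^~ n).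
Hypothesis M_law : forall n (s : nat -> nat),
  P [set u | forall i, (i < n)%N -> M u i = s i] = (\prod_(i < n) p i (s i))%:E.

Let mcyl n (s : nat -> nat) :
  measurable [set u | forall i, (i < n)%N -> M u i = s i].
Proof.
have -> : [set u | forall i, (i < n)%N -> M u i = s i] =
    \bigcap_i (M ^~ i @^-1` [set k | (i < n)%N -> k = s i]).
  by apply/seteqP; split => u /= H i => [_ /H//|/(H i I)].
apply: bigcapT_measurable => i; rewrite -[X in measurable X]setTI.
exact: mM.
Qed.

(* the event [S], with the values of the first [n] variables coded by [k] *)
Let fiber (S : set (nat -> nat)) n k :=
  [set o | S (M o) /\ choice.pickle (mkseq (M o) n) = k].

(** The [n]-th variable is independent of every event [S] depending on the
    previous ones only: such an event is a countable union of cylinders. *)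
Lemma independent_next (S : set (nat -> nat)) n c :
  (forall f g, (forall i, (i < n)%N -> f i = g i) -> S f -> S g) ->
  measurable [set o | S (M o)] /\
  P ([set o | S (M o)] `&` [set o | M o n = c]) =
  (P [set o | S (M o)] * (p n c)%:E)%E.
Proof.
move=> S_loc.
have fiberE k : fiber S n k = set0 \/ exists s,
  fiber S n k = [set u | forall i, (i < n)%N -> M u i = s i].
  have [->|] := eqVneq (fiber S n k) set0; first by left.
  move=> /set0P [w [Sw wk]]. right.
  exists (M w); apply/seteqP; split => u /=.
    move=> [_]; rewrite -wk => /(pcan_inj choice.pickleK) H i ni.
    by have := congr1 (fun t => nth 0%N t i) H; rewrite !nth_mkseq.
  move=> H; split; first by apply: S_loc Sw => i /H.
  rewrite -wk; congr choice.pickle; apply/eq_in_map => i.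
  by rewrite mem_iota => /H.
have SE : [set o | S (M o)] = \bigcup_k fiber S n k.
  apply/seteqP; split => u /= => [Su|[k _ []]//].
  by exists (choice.pickle (mkseq (M u) n)).
have mfiber k : measurable (fiber S n k).
  by have [->|[s ->]] := fiberE k.
have tfiber : trivIset setT (fiber S n).
  by apply/trivIsetP => i j _ _ /eqP ij; rewrite -subset0 => u [[_ ui] [_ uj]];
     apply: ij; rewrite -ui -uj.
have mnext : measurable [set o | M o n = c].
  rewrite -[X in measurable X]setTI; exact: (mM n measurableT (Y := [set c]) I).
have mS : measurable [set o | S (M o)].
  by rewrite SE; exact: bigcupT_measurable.
split => //.
rewrite SE setI_bigcupl measure_bigcup//; last 2 first.
- by move=> k _; exact: measurableI.
- by apply: trivIset_setIr.
rewrite measure_bigcup//.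
rewrite muleC -nneseriesZl//; apply: eq_eseriesr => k _.
have [->|[s ->]] := fiberE k; first by rewrite set0I measure0 mule0.
have -> : [set u | forall i, (i < n)%N -> M u i = s i] `&` [set o | M o n = c] =
  [set u | forall i, (i < n.+1)%N -> M u i = if (i < n)%N then s i else c].
  apply/seteqP; split => u /=.
    move=> [H1 H2] i; rewrite ltnS leq_eqVlt => /predU1P[->|ni].
      by rewrite ltnn.
    by rewrite ni; exact: H1.
  move=> H; split => [i ni|]; last by have := H n (ltnSn n); rewrite ltnn.
  by have := H i (ltnW ni); rewrite ni.
apply: etrans (M_law _ _) _; rewrite big_ord_recr/= ltnn EFinM muleC.
congr (_ * _)%E; apply: etrans (esym (M_law n s)); congr EFin.
by apply: eq_bigr => -[i ni] _ /=; rewrite ni.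
Qed.

End NextVariable.

(** [partial_sum n B f] is the sum of the [f i] over the [i < n] in [B]. *)
Definition partial_sum (V : nmodType) (n : nat) (B : set nat)
    (f : nat -> V) : V :=
  \sum_(i < n | (i : nat) \in B) f i.

Lemma partial_sumS (V : nmodType) n B (f : nat -> V) :
  partial_sum n.+1 B f = partial_sum n B f + (if n \in B then f n else 0).
Proof. by rewrite /partial_sum big_mkcond big_ord_recr /= -big_mkcond. Qed.

Lemma partial_sum_ge0 (R : numDomainType) n B (f : nat -> R) :
  (forall i, 0 <= f i) -> 0 <= partial_sum n B f.
Proof. by move=> f0; apply: sumr_ge0. Qed.

Section FiniteCounts.
Context (R : realType) (dO : measure_display) (O : measurableType dO).
Variables (P : probability O R) (M : O -> nat -> nat) (lam : nat -> R).
Hypothesis mM : forall n, measurable_fun setT (M ^~ n).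
Hypothesis M_law : forall n (s : nat -> nat),
  P [set u | forall i, (i < n)%N -> M u i = s i] =
  (\prod_(i < n) poisson_mass (lam i) (s i))%:E.

Variables (r : nat) (A : 'I_r -> set nat).
Hypothesis tA : trivIset setT A.

Let event n (k : 'I_r -> nat) : set (nat -> nat) :=
  [set f | forall j, partial_sum n (A j) f = k j].

Let event_loc n k f g : (forall i, (i < n)%N -> f i = g i) ->
  event n k f -> event n k g.
Proof.
move=> fg ef j; rewrite -(ef j); apply: eq_bigr => i _.
by rewrite fg.
Qed.

Lemma measurable_partial_counts n k :
  measurable [set o | forall j, partial_sum n (A j) (M o) = k j].
Proof.
by have [] := independent_next (p := fun i => poisson_mass (lam i)) mM M_law 0
  (@event_loc n k).
Qed.

(** Only one of the disjoint sets can contain the new index [n], and the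
    corresponding count is then convolved with the law of [M n]. *)
Lemma partial_counts_law n k :
  P [set o | forall j, partial_sum n (A j) (M o) = k j] =
  (\prod_j poisson_mass (partial_sum n (A j) lam) (k j))%:E.
Proof.
elim: n k => [|n IH] k.
  have E (V : nmodType) (B : set nat) (f : nat -> V) :
      partial_sum 0 B f = 0 :> V.
    by rewrite /partial_sum big_ord0.
  under eq_bigr do rewrite E poisson_mass0.
  have [k0|] := pselect (forall j, k j = 0%N).
    rewrite big1 => [|j _]; last by rewrite k0 eqxx.
    rewrite (_ : [set o | _] = setT) ?probability_setT//.
    by apply/seteqP; split => o // _ j; rewrite E k0.
  move=> /existsNP [j /eqP kj]; rewrite (bigD1 j)//= (negPf kj) mul0r.
  rewrite (_ : [set o | _] = set0) ?measure0//.
  rewrite -subset0 => o /(_ j); rewrite E => /esym /eqP.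
  by rewrite (negPf kj).
have [[j0 nj0]|nA] := pselect (exists j, A j n); last first.
  have E (V : nmodType) (f : nat -> V) j :
      partial_sum n.+1 (A j) f = partial_sum n (A j) f :> V.
    by rewrite partial_sumS memNset ?addr0// => Ajn; apply: nA; exists j.
  under eq_bigr do rewrite E.
  rewrite -IH; congr (P _); apply/seteqP.
  by split => o H j; rewrite -H E.
have nA j : j != j0 -> n \notin A j.
  move=> jj0; apply/negP => /set_mem nj.
  by move/eqP: jj0; apply; apply: (tA _ _) => //; exists n.
(* the counts before the index [n], when [M n] takes the value [c] *)
pose k' (c : nat) j := if j == j0 then (k j - c)%N else k j.
pose F c := [set o | event n (k' c) (M o)] `&` [set o | M o n = c].
have SE : [set o | forall j, partial_sum n.+1 (A j) (M o) = k j] =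
  \bigcup_(c in `I_(k j0).+1) F c.
  apply/seteqP; split => o /=.
    move=> H; have := H j0; rewrite partial_sumS mem_set// => Hj0.
    have ck : (M o n < (k j0).+1)%N.
      by rewrite ltnS -Hj0; exact: leq_addl.
    exists (M o n) => //; split => //= j.
    rewrite /k'; case: eqP => [->|/eqP jj0].
      by rewrite -Hj0 addnK.
    by rewrite -H partial_sumS (negPf (nA _ jj0)) addr0.
  move=> [c /= ck [H Mc]] j.
  have := H j; rewrite /k' partial_sumS; case: eqP => [->|/eqP jj0].
    by rewrite mem_set// Mc => ->; exact: subnK.
  by rewrite (negPf (nA _ jj0)) addr0.
have mnext c : measurable [set o | M o n = c].
  rewrite -[X in measurable X]setTI; exact: (mM n measurableT (Y := [set c]) I).
rewrite SE bigcup_mkord measure_bigsetU; last 2 first.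
- by move=> c; apply: measurableI => //; exact: measurable_partial_counts.
- apply/trivIsetP => i j _ _ /eqP ij; rewrite -subset0 => o.
  by move=> [[_ /= oi] [_ /= oj]]; apply: ij; rewrite -oi -oj.
rewrite (bigD1 j0)//= partial_sumS mem_set// -poisson_mass_conv mulr_suml.
rewrite -sumEFin; apply: eq_bigr => c _.
have [_ ->] := independent_next (p := fun i => poisson_mass (lam i)) mM M_law c
  (@event_loc n (k' c)).
rewrite IH -EFinM (bigD1 j0)//= /k' eqxx; congr EFin.
rewrite mulrAC; congr (_ * _).
apply: eq_bigr => j jj0.
by rewrite (negPf jj0) partial_sumS (negPf (nA _ jj0)) addr0.
Qed.

End FiniteCounts.

(** * Full counts and the Poisson point process *)

Lemma esum_countTypeE (R : realType) (E : countType) (A : set E)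
    (a : E -> \bar R) : (forall w, 0 <= a w)%E ->
  (\esum_(w in A) a w =
   \sum_(n <oo) oapp (fun w => if w \in A then a w else 0) 0 (pickle_inv n))%E.
Proof.
move=> a0.
pose g n := oapp (fun w => if w \in A then a w else 0)%E 0%E (@pickle_inv E n).
transitivity (\sum_(n <oo) g n)%E; last by [].
have g0 n : (0 <= g n)%E.
  by rewrite /g; case: (pickle_inv n) => [w|]//=; case: ifP.
rewrite nneseries_esumT// esum_mkcond.
transitivity (\esum_(n in (@choice.pickle E) @` setT) g n)%E.
  rewrite esum_image; last by move=> x y _ _ /(pcan_inj choice.pickleK).
  by apply: eq_esum => w _; rewrite /g choice.pickleK_inv.
rewrite esum_mkcond; apply: eq_esum => n _.
case: ifPn => // /negP nE; rewrite /g.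
case e : (pickle_inv n) => [w|]//=; exfalso; apply: nE; apply/mem_set.
exists w => //; have := @choice.pickle_invK E n.
by rewrite /ocancel /= e.
Qed.

Lemma measurable_point_count (R : realType) (dO : measure_display)
    (O : measurableType dO) (E : countType) (X : O -> E -> nat) (A : set E) :
  (forall w, measurable_fun setT (X ^~ w)) ->
  measurable_fun setT (fun o => point_count R (X o) A).
Proof.
move=> mX.
under eq_fun do rewrite /point_count esum_countTypeE//.
apply: ge0_emeasurable_sum => [n o _ _|n _].
  by case: (pickle_inv n) => [w|]//=; case: ifP.
case: (pickle_inv n) => [w|]//=; case: (w \in A) => //.
apply/measurable_EFinP.
by apply: (@measurableT_comp _ _ _ _ _ _ (fun k : nat => k%:R : R) _ (X ^~ w)).
Qed.

Lemma measurable_point_count_eq (R : realType) (dO : measure_display)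
    (O : measurableType dO) (E : countType) (X : O -> E -> nat) (A : set E) c :
  (forall w, measurable_fun setT (X ^~ w)) ->
  measurable [set o | point_count R (X o) A = c].
Proof.
move=> /(@measurable_point_count R _ _ _ _ A) /(_ measurableT [set c]).
by rewrite setTI; apply; exact: emeasurable_set1.
Qed.

Lemma partial_sum_cvg (R : realType) (B : set nat) (f : nat -> R) :
  (forall i, 0 <= f i) ->
  ((partial_sum n B f)%:E @[n --> \oo] --> \esum_(i in B) (f i)%:E)%E.
Proof.
move=> f0.
have -> : (\esum_(i in B) (f i)%:E = \sum_(i <oo | i \in B) (f i)%:E)%E.
  rewrite nneseries_esum; last by move=> *; rewrite lee_fin.
  by congr (esum _ _); rewrite set_mem_set.
rewrite (_ : (fun n => _) = (fun n => \sum_(0 <= i < n | i \in B) (f i)%:E)%E).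
  by apply: is_cvg_nneseries => n _ _; rewrite lee_fin.
by apply/funext => n; rewrite sumEFin big_mkord.
Qed.

Lemma partial_count_cvg (R : realType) (B : set nat) (m : nat -> nat) :
  ((partial_sum n B m)%:R%:E @[n --> \oo] --> point_count R m B)%E.
Proof.
have := @partial_sum_cvg R B (fun i => (m i)%:R) (fun i => ler0n _ _).
by under eq_fun do rewrite /partial_sum -natr_sum.
Qed.

(** The limit of a sequence of naturals decides whether its terms are eventually
    equal to [k] or eventually different from [k]. *)
Lemma nat_seq_cvg_eq (R : realType) (u : nat -> nat) (x : \bar R) k :
  ((u n)%:R%:E @[n --> \oo] --> x)%E ->
  \forall n \near \oo, (u n == k) = (x == k%:R%:E).
Proof.
move=> ux; have [xk|xk] := eqVneq x k%:R%:E.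
  move: ux; rewrite xk => /fine_cvgP [_ /cvgrPdist_lt /(_ 1 ltr01)].
  apply: filterS => n /= unk; apply: contraTT unk.
  rewrite neq_ltn -leNgt => /orP[h|h].
    by rewrite -natrB ?(ltnW h)// normr_nat ler1n subn_gt0.
  by rewrite distrC -natrB ?(ltnW h)// normr_nat ler1n subn_gt0.
have cl : closed [set (k%:R%:E : \bar R)].
  by apply/accessible_closed_set1/hausdorff_accessible; exact: ereal_hausdorff.
have : nbhs x (~` [set (k%:R%:E : \bar R)]).
  by apply: open_nbhs_nbhs; split; [exact: closed_openC|exact/eqP].
move=> /ux unk; near=> n; apply/negbTE/eqP => un.
have : (~` [set (k%:R%:E : \bar R)]) (u n)%:R%:E by near: n; exact: unk.
by rewrite un; apply.
Unshelve. all: by end_near.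
Qed.

(** Mass at [k] of the Poisson law of parameter [x]; no mass when [x] is
    infinite. *)
Definition epoisson_mass (R : realType) (x : \bar R) (k : nat) : R :=
  if x is r%:E then poisson_mass r k else 0.

Lemma epoisson_mass_cvg (R : realType) (u : nat -> R) (x : \bar R) k :
  (forall n, 0 <= u n) -> ((u n)%:E @[n --> \oo] --> x)%E ->
  poisson_mass (u n) k @[n --> \oo] --> epoisson_mass x k.
Proof.
move=> u0; case: x => [x||] ux /=.
- have {}ux : u n @[n --> \oo] --> x by move/fine_cvgP : ux => [].
  apply: (cvg_comp u (fun r => poisson_mass r k) ux).
  exact: (@continuous_poisson_mass R k x).
- have {}ux : u n @[n --> \oo] --> +oo by exact/cvgeryP.
  apply: (cvg_comp u (fun r => poisson_mass r k) ux).
  exact: (@poisson_mass_cvg0 R k).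
- have : (0 <= -oo :> \bar R)%E.
    rewrite -(cvg_lim _ ux)//; apply: lime_ge.
      by apply/cvg_ex; exists -oo%E.
    by apply: nearW => n; rewrite lee_fin.
  by [].
Qed.

Section ProbabilityLimits.
Context (R : realType) (dO : measure_display) (O : measurableType dO).
Variable P : probability O R.

Lemma probability_ae_eq (A B : set O) : measurable A -> measurable B ->
  {ae P, forall o, A o <-> B o} -> P A = P B.
Proof.
move=> mA mB AB.
rewrite -[A]setIT -[B]setIT -!integral_indic//.
apply: ae_eq_integral => //; [exact/measurable_EFinP|exact/measurable_EFinP|].
apply: filterS AB => o ABo _; rewrite !indicE; congr ((_ : bool)%:R%:E).
by apply/idP/idP => /set_mem/ABo/mem_set.
Qed.

Lemma probability_cvg (A : nat -> set O) (B : set O) :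
  (forall n, measurable (A n)) -> measurable B ->
  (forall o, \forall n \near \oo, A n o <-> B o) ->
  P (A n) @[n --> \oo] --> P B.
Proof.
move=> mA mB AB.
have E C : measurable C -> (\int[P]_o (\1_C o)%:E)%E = P C.
  by move=> mC; rewrite integral_indic// setIT.
rewrite -(E B)//; under eq_fun do rewrite -E//.
have mI C : measurable C -> measurable_fun setT (EFin \o (\1_C : O -> R)).
  by move=> mC; apply/measurable_EFinP; exact: measurable_indic.
have [| | |//] := @dominated_convergence _ _ _ P setT measurableT
  (fun n o => (\1_(A n) o)%:E) (fun o => (\1_B o)%:E) (cst 1%E)
  (fun n => mI _ (mA n)) (mI _ mB).
- apply: aeW => o _; apply: cvg_near_cst.
  have := AB o; apply: filterS => n ABo; rewrite !indicE.
  by congr ((_ : bool)%:R%:E); apply/idP/idP => /set_mem/ABo/mem_set.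
- exact: finite_measure_integrable_cst.
- by apply: aeW => o n _; rewrite indicE gee0_abs lee_fin ?ler0n// lern1 leq_b1.
Qed.

Lemma ae_probability1 (A : set O) :
  measurable A -> P A = 1%E -> {ae P, forall o, A o}.
Proof.
move=> mA PA; exists (~` A); split => //; first exact: measurableC.
by rewrite probability_setC// PA subee.
Qed.

(** Total probability over the finite values of an almost surely finite
    extended count. *)
Lemma total_probability_nat (Y : O -> \bar R) (A : set O) :
  measurable A -> (forall k : nat, measurable [set o | Y o = k%:R%:E]) ->
  {ae P, forall o, exists k : nat, Y o = k%:R%:E} ->
  P A = (\sum_(k <oo) P (A `&` [set o | Y o = k%:R%:E]))%E.
Proof.
move=> mA mY Y_nat.
have mI k : measurable (A `&` [set o | Y o = k%:R%:E]) by exact: measurableI.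
rewrite -measure_semi_bigcup//.
- apply: probability_ae_eq => //; first exact: bigcupT_measurable.
  by apply: filterS Y_nat => o [k Yk]; split => [Ao|[? _ []]//]; exists k.
- apply/trivIsetP => i j _ _ /eqP ij; rewrite -subset0 => o.
  move=> [[_ /= oi] [_ /= oj]].
  by apply: ij; move: oi; rewrite oj => -[] /eqP; rewrite eqr_nat => /eqP.
- exact: bigcupT_measurable.
Qed.

End ProbabilityLimits.

Lemma point_count_nat (R : realType) (m : nat -> nat) (A : set nat) :
  point_count R m A = +oo%E \/ exists k : nat, point_count R m A = k%:R%:E.
Proof.
have := @partial_count_cvg R A m.
have : (0 <= point_count R m A)%E by apply: esum_ge0 => i _; rewrite lee_fin.
case: (point_count R m A) => [x||]// _; [|by left].
move=> /fine_cvgP [_ ux]; right.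
set u := (X in X @ _ --> _) in ux.
have [N _ HN] : \forall n \near \oo, `|x - u n| < 2^-1.
  by move/cvgrPdist_lt : ux; apply; rewrite invr_gt0.
(* all the terms past N are integers at distance less than 1 of each other *)
have uN n : (N <= n)%N -> partial_sum n A m = partial_sum N A m.
  move=> Nn; apply: contraTeq (HN n Nn) => neq.
  have dN := HN N (leqnn N); rewrite -leNgt.
  have : 1 <= `|u n - u N|.
    rewrite /u /=; move: neq; rewrite neq_ltn => /orP[h|h].
      by rewrite distrC -natrB ?(ltnW h)// normr_nat ler1n subn_gt0.
    by rewrite -natrB ?(ltnW h)// normr_nat ler1n subn_gt0.
  have := ler_distD x (u n) (u N); rewrite (distrC (u n) x).
  lra.
exists (partial_sum N A m); congr EFin.
apply: (cvg_unique _ ux) => //; apply: cvg_near_cst; exists N => // n Nn /=.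
by rewrite /u /= uN.
Qed.

Section Independence.
Context (R : realType) (dO : measure_display) (O : measurableType dO).
Variables (P : probability O R) (M : O -> nat -> nat) (lam : nat -> R).
Hypothesis lam_ge0 : forall n, 0 <= lam n.
Hypothesis mM : forall n, measurable_fun setT (M ^~ n).
Hypothesis M_law : forall n (s : nat -> nat),
  P [set u | forall i, (i < n)%N -> M u i = s i] =
  (\prod_(i < n) poisson_mass (lam i) (s i))%:E.

Let Lam (B : set nat) : \bar R := \esum_(i in B) (lam i)%:E.

Let mcount B c : measurable [set o | point_count R (M o) B = c].
Proof. exact: measurable_point_count_eq. Qed.

(** The counts of disjoint sets are jointly Poisson, as limits of the partial
    counts; a set of infinite intensity has no finite count. *)
Lemma point_counts_law r (A : 'I_r -> set nat) (k : 'I_r -> nat) :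
  trivIset setT A ->
  P [set o | forall j, point_count R (M o) (A j) = (k j)%:R%:E] =
  (\prod_j epoisson_mass (Lam (A j)) (k j))%:E.
Proof.
move=> tA.
have lim1 :
  P [set o | forall j, partial_sum n (A j) (M o) = k j] @[n --> \oo] -->
    P [set o | forall j, point_count R (M o) (A j) = (k j)%:R%:E].
  apply: probability_cvg => [n||o].
  - exact: (measurable_partial_counts mM M_law).
  - rewrite (_ : [set o | _] =
      \bigcap_j [set o | point_count R (M o) (A j) = (k j)%:R%:E]).
      by apply: fin_bigcap_measurable => // j _; exact: mcount.
    by apply/seteqP; split => o H j => [_|]; [exact: H|exact: (H j I)].
  - have H j := nat_seq_cvg_eq (k j) (@partial_count_cvg R (A j) (M o)).
    apply: (filterS _ (filter_forall _ H)) => n {}H.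
    split => /= E j; have := H j; rewrite E eqxx; last by move/eqP.
    by move=> /esym/eqP.
have lim2 :
  P [set o | forall j, partial_sum n (A j) (M o) = k j] @[n --> \oo] -->
    (\prod_j epoisson_mass (Lam (A j)) (k j))%:E.
  under eq_fun do rewrite (partial_counts_law mM M_law tA).
  apply: cvg_EFin; first exact: nearW.
  apply: cvg_big; first exact: mul_continuous.
  move=> j _; apply: epoisson_mass_cvg; last exact: partial_sum_cvg.
  by move=> n; exact: partial_sum_ge0.
exact: (cvg_unique _ lim1 lim2).
Qed.

Lemma point_count_law (B : set nat) (k : nat) :
  P [set o | point_count R (M o) B = k%:R%:E] = (epoisson_mass (Lam B) k)%:E.
Proof.
have := @point_counts_law 1 (fun=> B) (fun=> k).
rewrite big_ord1 => <-.
  by congr (P _); apply/seteqP; split => o //= /(_ ord0).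
by move=> i j _ _ _; rewrite !ord1.
Qed.

Lemma ae_point_count_infinite (B : set nat) : Lam B = +oo%E ->
  {ae P, forall o, point_count R (M o) B = +oo%E}.
Proof.
move=> LB.
have : {ae P, forall o, forall k : nat, point_count R (M o) B <> k%:R%:E}.
  apply/ae_foralln => k; exists [set o | point_count R (M o) B = k%:R%:E].
  split => //; first by apply: etrans (point_count_law B k) _; rewrite LB.
  by move=> o /= /contrapT.
by apply: filterS => o ok; have [//|[k /ok]] := point_count_nat R (M o) B.
Qed.

Lemma Lam_finite (B : set nat) : (Lam B < +oo)%E ->
  exists2 x : R, 0 <= x & Lam B = x%:E.
Proof.
have : (0 <= Lam B)%E by apply: esum_ge0 => i _; rewrite lee_fin.
by case: (Lam B) => [x||]// x0 _; exists x.
Qed.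

Lemma ae_point_count_finite (B : set nat) : (Lam B < +oo)%E ->
  {ae P, forall o, exists k : nat, point_count R (M o) B = k%:R%:E}.
Proof.
move=> /Lam_finite[x x0 LB].
pose F (k : nat) := [set o | point_count R (M o) B = k%:R%:E].
have mFk k : measurable (F k) by exact: mcount.
have mF : measurable (\bigcup_k F k) by exact: bigcupT_measurable.
have : P (\bigcup_k F k) = 1%E.
  rewrite measure_semi_bigcup//.
    rewrite -(poisson_mass_sumE x0); apply: eq_eseriesr => k _.
    by apply: etrans (point_count_law B k) _; rewrite LB.
  apply/trivIsetP => i j _ _ /eqP ij; rewrite -subset0 => o [/= oi oj].
  by apply: ij; move: oi; rewrite /F /= oj => -[] /eqP; rewrite eqr_nat => /eqP.
by move=> /(ae_probability1 mF); apply: filterS => o [k _ Fk]; exists k.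
Qed.

Lemma point_count_Poisson (B : set nat) k : (Lam B < +oo)%E ->
  P [set o | point_count R (M o) B = k%:R%:E] =
  poisson_prob (fine (Lam B)) 0 [set k].
Proof.
move=> /Lam_finite[x x0 LB].
by rewrite point_count_law LB /= poisson_prob_set1.
Qed.

(** Independence of counts with finite intensities. The coordinates listed in
    [s] carry arbitrary events, the others single values, and [s] grows one
    coordinate at a time by total probability. *)
Lemma independent_finite_counts_rec r (A : 'I_r -> set nat) (s : seq 'I_r)
    (B : 'I_r -> set (\bar R)) :
  trivIset setT A -> (forall j, (Lam (A j) < +oo)%E) ->
  (forall j, measurable (B j)) ->
  (forall j, j \notin s -> exists k : nat, B j = [set k%:R%:E]) ->
  P (\bigcap_j ((fun o => point_count R (M o) (A j)) @^-1` B j)) =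
  (\prod_j P ((fun o => point_count R (M o) (A j)) @^-1` B j))%E.
Proof.
move=> tA finA; elim: s B => [|j s IH] B mB sB.
  have /choice[k kB] : forall j, exists k : nat, B j = [set k%:R%:E].
    by move=> j; exact: sB.
  transitivity (P [set o | forall j, point_count R (M o) (A j) = (k j)%:R%:E]).
    congr (P _); apply/seteqP; split => o H j.
      by have := H j I; rewrite /= kB.
    by move=> _; rewrite /= kB; exact: H.
  rewrite point_counts_law// -prodEFin; apply: eq_bigr => j _.
  by rewrite kB; exact/esym/point_count_law.
pose Y i o := point_count R (M o) (A i).
have mY i : measurable_fun setT (Y i) by exact: measurable_point_count.
have mYB i C : measurable C -> measurable (Y i @^-1` C).
  by move=> mC; rewrite -[X in measurable X]setTI; exact: mY.
have mYk i (k : nat) : measurable [set o | Y i o = k%:R%:E] by exact: mcount.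
pose B' (k : nat) i := if i == j then [set k%:R%:E] else B i.
have mB' k i : measurable (B' k i).
  by rewrite /B'; case: ifP => // _; exact: emeasurable_set1.
have B'E k : P (\bigcap_i (Y i @^-1` B' k i)) =
    (P [set o | Y j o = k%:R%:E] * \prod_(i < r | i != j) P (Y i @^-1` B i))%E.
  rewrite IH//; last first.
    move=> i si; rewrite /B'; case: eqP => [_|/eqP ij]; first by exists k.
    by apply: sB; rewrite inE negb_or ij.
  rewrite (bigD1 j)//= /B' eqxx; congr (_ * _)%E.
  by apply: eq_bigr => i /negPf ->.
set c := (\prod_(i < r | i != j) P (Y i @^-1` B i))%E in B'E *.
have [y cE] : exists y : R, c = y%:E.
  exists (\prod_(i < r | i != j) fine (P (Y i @^-1` B i))).
  rewrite -prodEFin; apply: eq_bigr => i _.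
  by rewrite fineK// fin_num_measure//; exact: mYB.
transitivity (\sum_(k <oo)
    P (\bigcap_i (Y i @^-1` B i) `&` [set o | Y j o = k%:R%:E]))%E.
  apply: total_probability_nat => //; last exact: ae_point_count_finite.
  by apply: fin_bigcap_measurable => // i _; exact: mYB.
rewrite (bigD1 j)//= -/c.
rewrite (total_probability_nat (mYB j _ (mB j)) (mYk j)); last first.
  exact: ae_point_count_finite.
rewrite cE muleC -nneseriesZl//; apply: eq_eseriesr => k _.
have [kB|kB] := pselect (B j k%:R%:E).
  rewrite (_ : _ `&` _ = \bigcap_i (Y i @^-1` B' k i)); last first.
    apply/seteqP; split => o /=.
      by move=> [H Yk] i _; rewrite /B'; case: eqP => [->//|_]; exact: H.
    move=> H; have := H j I; rewrite /B' eqxx => Yj; split => // i _.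
    have [->|/negPf ij] := eqVneq i j; first by rewrite /= Yj.
    by have := H i I; rewrite /B' ij.
  rewrite B'E cE muleC; congr (_ * P _)%E.
  by apply/seteqP; split => o /= => [Yk|[]//]; split => //; rewrite Yk.
rewrite (_ : _ `&` _ = set0); last first.
  by rewrite -subset0 => o [/= H Yk]; apply: kB; rewrite -Yk; exact: H.
rewrite (_ : _ `&` _ = set0) ?measure0 ?mule0//.
by rewrite -subset0 => o [/= H Yk]; apply: kB; rewrite -Yk.
Qed.

(** A count with infinite intensity is almost surely infinite, so that its
    set may be replaced with the empty one and its event with a trivial one. *)
Lemma mutually_independent_point_counts r (A : 'I_r -> set nat) :
  trivIset setT A ->
  mutually_independent P (fun i o => point_count R (M o) (A i)).
Proof.
move=> tA B mB.
pose A' j := if (Lam (A j) < +oo)%E then A j else set0.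
pose B' j := if (Lam (A j) < +oo)%E then B j else
  if +oo%E \in B j then setT else set0.
have mB' j : measurable (B' j) by rewrite /B'; case: ifP => // _; case: ifP.
have mYB (C : set nat) (D : set (\bar R)) : measurable D ->
    measurable ((fun o => point_count R (M o) C) @^-1` D).
  move=> mD; rewrite -[X in measurable X]setTI.
  by have := @measurable_point_count R _ _ _ M C mM measurableT D mD.
have A'A j : {ae P, forall o, B j (point_count R (M o) (A j)) <->
                              B' j (point_count R (M o) (A' j))}.
  rewrite /A' /B'; case: ifPn => finA; first by apply: aeW => o.
  have /ae_point_count_infinite : Lam (A j) = +oo%E.
    by apply/eqP; rewrite -leye_eq leNgt.
  apply: filterS => o ->; case: ifPn => [/set_mem Boo|nB]; first by split.
  by split => // Boo; move: nB; rewrite mem_set.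
transitivity (P (\bigcap_j ((fun o => point_count R (M o) (A' j)) @^-1` B' j))).
  apply: probability_ae_eq.
  - by apply: fin_bigcap_measurable => // j _; exact: mYB.
  - by apply: fin_bigcap_measurable => // j _; exact: mYB.
  - apply: (filterS _ (filter_forall _ A'A)) => o H.
    by split => /= K j _; apply/H; exact: K.
rewrite (independent_finite_counts_rec (s := enum 'I_r))//.
- apply: eq_bigr => j _; apply/esym.
  by apply: probability_ae_eq (A'A j); exact: mYB.
- apply/trivIsetP => i j _ _ ij; rewrite /A'.
  case: ifP => _; last by rewrite set0I.
  case: ifP => _; last by rewrite setI0.
  by move/trivIsetP : tA; apply.
- move=> j; rewrite /A'; case: ifPn => // _.
  by rewrite /Lam esum_set0.
- by move=> j; rewrite mem_enum.
Qed.

End Independence.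

(** Any nonnegative weights on a countable space are the intensities of a
    Poisson point process. *)
Lemma exists_Poisson_point_process (R : realType) (E : countType)
    (lam : E -> R) : (forall i, 0 <= lam i) ->
  exists (dO : measure_display) (O : measurableType dO) (P : probability O R)
    (X : O -> E -> nat),
    Poisson_point_process P (fun A => \esum_(i in A) (lam i)%:E) X.
Proof.
move=> lam_ge0.
pose lamN n := oapp lam 0 (@pickle_inv E n).
have lamN_ge0 n : 0 <= lamN n by rewrite /lamN; case: pickle_inv.
have [dO [Om [P [M [mM M_law]]]]] := independent_nat_sequence
  (fun n k => poisson_mass_ge0 k (lamN_ge0 n))
  (fun n => poisson_mass_sum (lamN_ge0 n)).
exists dO, Om, P, (fun o i => M o (choice.pickle i)).
have inj (A : set E) : set_inj A (@choice.pickle E).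
  by move=> x y _ _ /(pcan_inj choice.pickleK).
have countE o (A : set E) : point_count R (fun i => M o (choice.pickle i)) A =
    point_count R (M o) (choice.pickle @` A).
  by rewrite /point_count esum_image.
have LamE (A : set E) : \esum_(i in A) (lam i)%:E =
    \esum_(n in choice.pickle @` A) (lamN n)%:E.
  rewrite esum_image//; apply: eq_esum => i _.
  by rewrite /lamN choice.pickleK_inv.
split.
- by move=> i; exact: mM.
- move=> A; rewrite LamE => finA k; under eq_set do rewrite countE.
  exact: (point_count_Poisson lamN_ge0 mM M_law).
- move=> A; rewrite LamE => infA; under eq_set do rewrite countE.
  have mS :
      measurable [set o | point_count R (M o) (choice.pickle @` A) = +oo%E].
    exact: measurable_point_count_eq.
  rewrite -(@probability_setT _ _ _ P); apply: probability_ae_eq => //.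
  have := ae_point_count_infinite lamN_ge0 mM M_law infA.
  by apply: filterS => o; split.
- move=> n A tA.
  under eq_fun do under eq_fun do rewrite countE.
  apply: (mutually_independent_point_counts lamN_ge0 mM M_law).
  apply/trivIsetP => i j _ _ ij; rewrite -subset0 => m [[x Ax <-]].
  move=> [y Ay /(pcan_inj choice.pickleK) xy].
  by move/trivIsetP : tA => /(_ i j I I ij); rewrite -subset0; apply; split;
    [exact: Ax|rewrite -xy].
Qed.

(** * Sums over countable types *)

Lemma esum_bigcup_disjoint (R : realType) (T K : choiceType) (A : set K)
    (J : K -> set T) (a : T -> \bar R) :
  trivIset A J -> (forall x, 0 <= a x)%E ->
  (\esum_(i in \bigcup_(k in A) J k) a i =
   \esum_(k in A) \esum_(i in J k) a i)%E.
Proof.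
move=> tJ a0; rewrite esum_esum//; apply: reindex_esum; split.
- by move=> [k i] /= [Ak Jki]; exists k.
- move=> [k i] [l j] /set_mem[/= Ak Jki] /set_mem[/= Al Jlj] ij.
  congr pair => //; apply: (tJ k l) => //.
  by exists i; split => //; rewrite ij.
- by move=> i [k Ak Jki]; exists (k, i).
Qed.

Lemma esumZl (R : realType) (E : countType) (A : set E) (c : R)
    (a : E -> \bar R) : 0 <= c -> (forall i, 0 <= a i)%E ->
  (\esum_(i in A) (c%:E * a i) = c%:E * \esum_(i in A) a i)%E.
Proof.
move=> c0 a0.
have c0' : (0 <= c%:E)%E by rewrite lee_fin.
rewrite [RHS]muleC !esum_countTypeE//; last by move=> i; exact: mule_ge0.
rewrite [RHS]muleC -nneseriesZl; last first.
  by move=> n _; case: pickle_inv => [w|]//=; case: ifP.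
apply: eq_eseriesr => n _; case: pickle_inv => [w|]/=; last by rewrite mule0.
by case: ifP => // _; rewrite mule0.
Qed.

Lemma esum_II (R : realType) n (a : nat -> \bar R) : (forall i, 0 <= a i)%E ->
  (\esum_(i in `I_n) a i = \sum_(i < n) a i)%E.
Proof. by move=> a0; rewrite esum_fset// fsbig_ord. Qed.

(** * The mapping theorem *)

(** The image of a Poisson point process by a partial map [f] whose fibers have
    finite intensity. *)
Section PoissonMap.
Context (R : realType) (dO : measure_display) (O : measurableType dO).
Variables (P : probability O R) (E F : countType).
Variables (Lam : set E -> \bar R) (M : O -> E -> nat).
Hypothesis PM : Poisson_point_process P Lam M.
Variables (f : E -> option F).

Let pre (A : set F) : set E := [set i | exists2 w, A w & f i = Some w].

Hypothesis Lam_pre : forall w, (0 <= Lam (pre [set w]) < +oo)%E.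

(** The number of points above [w]; it is set to 0 on the null event where this
    number is infinite. *)
Let X (o : O) (w : F) : nat :=
  xget 0%N [set k | point_count R (M o) (pre [set w]) = k%:R%:E].

Let mM w : measurable_fun setT (M ^~ w).
Proof. by case: PM. Qed.

Let good := [set o | forall w, exists k : nat,
  point_count R (M o) (pre [set w]) = k%:R%:E].

Let XE o w : good o -> (X o w)%:R%:E = point_count R (M o) (pre [set w]).
Proof.
by move=> /(_ w)[k Ek]; rewrite /X; case: xgetP => [j _ -> //|/(_ k)].
Qed.

Let count_XE o A : good o ->
  point_count R (X o) A = point_count R (M o) (pre A).
Proof.
move=> go; rewrite /point_count.
have -> : pre A = \bigcup_(w in A) pre [set w].
  apply/seteqP; split => i [w Aw]; first by exists w => //; exists w.
  by move=> [v ->]; exists w.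
rewrite esum_bigcup_disjoint//.
  by apply: eq_esum => w _; rewrite XE.
apply/trivIsetP => w v _ _ /eqP wv; rewrite -subset0 => i.
move=> [[w' /= -> fw] [v' /= -> fv]].
by apply: wv; move: fv; rewrite fw => -[].
Qed.

Let ae_good : {ae P, forall o, good o}.
Proof.
have H w : {ae P, forall o, exists k : nat,
    point_count R (M o) (pre [set w]) = k%:R%:E}.
  have [_ law _ _] := PM.
  have /andP[L0 Loo] := Lam_pre w.
  pose G (k : nat) := [set o | point_count R (M o) (pre [set w]) = k%:R%:E].
  have mG k : measurable (G k) by exact: measurable_point_count_eq.
  have mUG : measurable (\bigcup_k G k) by exact: bigcupT_measurable.
  have : P (\bigcup_k G k) = 1%E.
    rewrite measure_semi_bigcup//.
      have x0 : 0 <= fine (Lam (pre [set w])) by exact: fine_ge0.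
      rewrite -(poisson_mass_sumE x0); apply: eq_eseriesr => k _.
      by apply: etrans (law _ Loo k) _; rewrite poisson_prob_set1.
    apply/trivIsetP => i j _ _ /eqP ij; rewrite -subset0 => o [/= oi oj].
    by apply: ij; move: oi; rewrite /G /= oj => -[] /eqP; rewrite eqr_nat => /eqP.
  by move=> /(ae_probability1 mUG); apply: filterS => o [k _ Gk]; exists k.
have : {ae P, forall o, forall n, oapp (fun w => exists k : nat,
    point_count R (M o) (pre [set w]) = k%:R%:E) True (@pickle_inv F n)}.
  apply/ae_foralln => n; case: pickle_inv => [w|]; first exact: H.
  exact: aeW.
apply: filterS => o Ho w.
by have := Ho (choice.pickle w); rewrite choice.pickleK_inv.
Qed.

Let mX w : measurable_fun setT (X ^~ w).
Proof.
move=> _ Y _; rewrite setTI.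
pose C (k : nat) := [set o | point_count R (M o) (pre [set w]) = k%:R%:E].
have mC k : measurable (C k) by exact: measurable_point_count_eq.
have -> : X ^~ w @^-1` Y = \bigcup_k (if k \in Y then C k else set0) `|`
    (if 0%N \in Y then ~` \bigcup_k C k else set0).
  apply/seteqP; split => o.
    rewrite /X /=; case: xgetP => [k _ Ck Yk|nC Y0].
      by left; exists k => //; rewrite mem_set.
    by right; rewrite mem_set// => -[k _ /nC].
  case => [[k _]|]; case: ifPn => // /set_mem Yk.
    move=> Ck; rewrite /X /=; case: xgetP => [j _ /= Cj|/(_ k)//].
    suff -> : j = k by [].
    by move: Cj; rewrite Ck => -[] /eqP; rewrite eqr_nat => /eqP.
  move=> nC; rewrite /X /=; case: xgetP => // k _ Ck.
  by exfalso; apply: nC; exists k.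
apply: measurableU; last first.
  by case: ifP => // _; apply: measurableC; exact: bigcupT_measurable.
by apply: bigcupT_measurable => k; case: ifP.
Qed.

(** The image process agrees with the original one only almost surely, because
    the multiplicities [X o w] have to be finite for all [o]. *)
Lemma Poisson_point_process_map (mu : set F -> \bar R) :
  (forall A, mu A = Lam (pre A)) ->
  exists X : O -> F -> nat, Poisson_point_process P mu X /\
    {ae P, forall o, forall w, (X o w)%:R%:E =
       point_count R (M o) [set i | f i = Some w]}.
Proof.
move=> muE; exists X; split; last first.
  apply: filterS ae_good => o go w; rewrite XE//; congr point_count.
  by apply/seteqP; split => i /=; [move=> [_ -> ]|exists w].
have [_ law infty indep] := PM.
have mXA A c : measurable [set o | point_count R (X o) A = c].
  exact: measurable_point_count_eq.
have mMA A c : measurable [set o | point_count R (M o) A = c].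
  exact: measurable_point_count_eq.
have PE A c : P [set o | point_count R (X o) A = c] =
    P [set o | point_count R (M o) (pre A) = c].
  apply: probability_ae_eq => //.
  by apply: filterS ae_good => o /count_XE /= ->.
split => //.
- by move=> A; rewrite muE => finA k; rewrite PE law.
- by move=> A; rewrite muE => infA; rewrite PE infty.
- move=> n A tA B mB.
  have tpre : trivIset setT (pre \o A).
    apply/trivIsetP => i j _ _ ij; rewrite -subset0 => x [[w Aw fw] [v Av]].
    rewrite fw => -[wv]; move/trivIsetP : tA => /(_ i j I I ij).
    by rewrite -subset0; apply; split; [exact: Aw|rewrite wv].
  have mYB (E' : countType) (Y : O -> E' -> nat) (C : set E') (D : set (\bar R)) :
      (forall w, measurable_fun setT (Y ^~ w)) -> measurable D ->
      measurable ((fun o => point_count R (Y o) C) @^-1` D).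
    move=> mY mD; rewrite -[X in measurable X]setTI.
    by have := @measurable_point_count R _ _ _ Y C mY measurableT D mD.
  transitivity (P (\bigcap_i
      ((fun o => point_count R (M o) ((pre \o A) i)) @^-1` B i))).
    apply: probability_ae_eq.
    + by apply: fin_bigcap_measurable => // i _; exact: mYB.
    + by apply: fin_bigcap_measurable => // i _; exact: mYB.
    + apply: filterS ae_good => o go.
      by split => H i _; have := H i I; rewrite /= count_XE.
  rewrite indep//; apply: eq_bigr => i _; apply: probability_ae_eq.
  + exact: mYB.
  + exact: mYB.
  + by apply: filterS ae_good => o go; rewrite /= count_XE.
Qed.

End PoissonMap.

(** * Simple random walks on the lattice *)

Lemma int_sqr_eq1 (z : int) : z ^+ 2 = 1 -> z = 1 \/ z = -1.
Proof. by move=> /eqP; rewrite sqrf_eq1 => /orP[]/eqP; [left|right]. Qed.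

Lemma int_sqr_ge1 (z : int) : z != 0 -> 1 <= z ^+ 2.
Proof. by move=> z0; rewrite -gtz0_ge1 exprn_even_gt0. Qed.

Section Neighbors.
Variable d : nat.
Local Notation nn := (@nearest_neighbor d).

(** The neighbor of [x] in the direction [ib.1], with the sign given by [ib.2]. *)
Let shift (x : lattice d) (ib : 'I_d * bool) : lattice d :=
  x - (-1) ^+ ib.2 *: delta_mx ord0 ib.1.

Let shiftE (x : lattice d) ib i :
  x ord0 i - shift x ib ord0 i = (-1) ^+ ib.2 * (i == ib.1)%:R.
Proof. by rewrite !mxE eqxx /= opprB addrC subrK. Qed.

Lemma shift_bij (x : lattice d) :
  set_bij [set: 'I_d * bool] [set y | nn x y] (shift x).
Proof.
split.
- move=> [i b] _ /=; rewrite /nearest_neighbor (bigD1 i)//= shiftE/= eqxx mulr1.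
  rewrite big1 ?addr0 => [|j /negPf ji]; last by rewrite shiftE/= ji mulr0 expr0n.
  by rewrite sqrr_sign.
- move=> [i b] [j c] _ _ ijE.
  have := shiftE x (i, b) i; rewrite ijE shiftE /= eqxx mulr1.
  have [<-|ij] := eqVneq i j; last first.
    by case: b {ijE} => /eqP; rewrite mulr0 ?expr0 ?expr1.
  by rewrite mulr1; case: b c {ijE} => [] [].
- move=> y /= /eqP xy.
  have [i zi] : exists i, x ord0 i - y ord0 i != 0.
    apply/existsP; rewrite -negb_forall; apply/negP => /forallP z0.
    by move: xy; rewrite big1// => i _; rewrite (eqP (z0 i)) expr0n.
  have sq_ge0 j : j != i -> 0 <= (x ord0 j - y ord0 j) ^+ 2 by rewrite sqr_ge0.
  have rest_ge0 : 0 <= \sum_(j < d | j != i) (x ord0 j - y ord0 j) ^+ 2.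
    by apply: sumr_ge0.
  rewrite (bigD1 i)//= in xy.
  have zi1 := int_sqr_ge1 zi.
  have split1 (a b : int) : a + b = 1 -> 1 <= a -> 0 <= b -> a = 1 /\ b = 0.
    by lia.
  have [{}zi1 /(psumr_eq0P sq_ge0) rest0] := split1 _ _ xy zi1 rest_ge0.
  exists (i, x ord0 i - y ord0 i == -1) => //.
  apply/rowP => j; apply: oppr_inj; apply: (addrI (x ord0 j)).
  rewrite shiftE /=; have [->|ji] := eqVneq j i.
    by rewrite mulr1; case: (int_sqr_eq1 zi1) => ->.
  by apply/esym/eqP; rewrite mulr0 -sqrf_eq0; apply/eqP; exact: rest0.
Qed.

End Neighbors.

Section Walks.
Variables (R : realType) (d : nat).
Hypothesis d_gt0 : (0 < d)%N.
Local Notation nn := (@nearest_neighbor d).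
Local Notation step := ((2 * d)%:R^-1 : R).

Let step_ge0 : 0 <= step. Proof. by rewrite invr_ge0. Qed.

Lemma esum_neighbors (x : lattice d) :
  (\esum_(y in [set y | nn x y]) step%:E = 1)%E.
Proof.
rewrite (reindex_esum _ _ _ _ (shift_bij x)).
rewrite esum_fset; [|exact: finite_finset|by move=> i _; rewrite lee_fin].
rewrite (fsbigE (index_enum ('I_d * bool)%type)) ?index_enum_uniq//; last first.
  by move=> i _; rewrite mem_index_enum.
rewrite (eq_bigl xpredT) => [|i]; last by rewrite in_setT.
rewrite sumEFin sumr_const card_prod card_ord card_bool.
rewrite -[X in X%:E]mulr_natr (mulnC d 2) mulVf// pnatr_eq0 muln_eq0/= -lt0n.
by rewrite d_gt0.
Qed.

(** The probabilities of the paths of length [m] started at [x] add up to 1. *)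
Lemma esum_paths (x : lattice d) m :
  (\esum_(v in [set v | size v = m /\ path nn x v]) (step ^+ m)%:E = 1)%E.
Proof.
elim: m x => [|m IH] x.
  rewrite (_ : [set v | _] = [set [::]]); first by rewrite esum_set1.
  apply/seteqP; split => [v [/size0nil //]|v ->]; by [].
have -> : [set v | size v = m.+1 /\ path nn x v] =
    \bigcup_(y in [set y | nn x y])
      (cons y @` [set v | size v = m /\ path nn y v]).
  apply/seteqP; split.
    move=> [|y v] /=; first by case.
    by move=> [[vm] /andP xyv]; have [xy yv] := xyv; exists y => //; exists v.
  by move=> _ [y xy [v [vm yv] <-]] /=; rewrite vm; split => //; apply/andP.
rewrite esum_bigcup_disjoint; last 2 first.
- by move=> y z _ _ [_ [[v _ <-] [w _ []]]].
- by move=> v; rewrite lee_fin exprn_ge0.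
rewrite -[RHS](esum_neighbors x); apply: eq_esum => y _.
rewrite esum_image; last by move=> v w _ _ [].
rewrite -[RHS]mule1 -[X in (_ * X)%E](IH y) -esumZl//.
by apply: eq_esum => v _; rewrite exprS EFinM.
Qed.

(** Mass given to a single walk of length [k] by the intensity measure of
    [FI^{u,T}]. *)
Definition walk_intensity (u T : R) (k : nat) : R :=
  (2 * d)%:R * u * (T + 1)^-1 ^+ 2 * (T / (T + 1)) ^+ k * step ^+ k.

Lemma FI_intensityE (u T : R) (A : set (walk d)) : 0 <= u -> 0 < T ->
  FI_intensity u T A = \esum_(w in A) (walk_intensity u T (walk_length w))%:E.
Proof.
move=> u0 T0.
have T1 : 0 < T + 1 by rewrite addr_gt0.
have p0 : 0 <= T / (T + 1) by rewrite divr_ge0// ltW.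
pose S x k := A `&` [set w | walk_start w = x /\ walk_length w = k].
have killedE x : (killed_walk_law T x A = \esum_(k in setT)
    \esum_(w in S x k) ((T / (T + 1)) ^+ k * (T + 1)^-1 * step ^+ k)%:E)%E.
  rewrite /killed_walk_law nneseries_esumT; last first.
    move=> k; apply: mule_ge0; last first.
      by apply: esum_ge0 => w _; rewrite lee_fin exprn_ge0.
    by rewrite lee_fin mulr_ge0 ?exprn_ge0// invr_ge0 ltW.
  apply: eq_esum => k _; rewrite /srw_law -/(S x k) -esumZl.
  - by apply: eq_esum => w _; rewrite EFinM.
  - by rewrite mulr_ge0 ?exprn_ge0// invr_ge0 ltW.
  - by move=> w; rewrite lee_fin exprn_ge0.
have c0 k : 0 <= (T / (T + 1)) ^+ k * (T + 1)^-1 * step ^+ k.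
  by rewrite !mulr_ge0 ?exprn_ge0// invr_ge0 ltW.
rewrite /FI_intensity.
transitivity (u%:E * \esum_(w in A) (((2 * d)%:R / (T + 1))%:E *
  ((T / (T + 1)) ^+ (walk_length w) * (T + 1)^-1 *
   step ^+ (walk_length w))%:E))%E.
  congr (_ * _)%E.
  have AE : A = \bigcup_(x in setT) \bigcup_(k in setT) S x k.
    apply/seteqP; split => [w Aw|w [x _ [k _ []]]//].
    by exists (walk_start w) => //; exists (walk_length w).
  rewrite [in RHS]AE esum_bigcup_disjoint; last 2 first.
  - by move=> x y _ _ [w [[k _ [_ /= [<- _]]] [l _ [_ /= [<- _]]]]].
  - by move=> w; rewrite -EFinM lee_fin mulr_ge0// divr_ge0// ltW.
  apply: eq_esum => x _; rewrite killedE -esumZl; last 2 first.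
  - by rewrite divr_ge0// ltW.
  - by move=> k; apply: esum_ge0 => w _; rewrite lee_fin.
  rewrite esum_bigcup_disjoint; last 2 first.
  - by move=> k l _ _ [w [[_ /= [_ <-]] [_ /= [_ <-]]]].
  - by move=> w; rewrite -EFinM lee_fin mulr_ge0// divr_ge0// ltW.
  apply: eq_esum => k _; rewrite -esumZl; last 2 first.
  - by rewrite divr_ge0// ltW.
  - by move=> w; rewrite lee_fin.
  by apply: eq_esum => w [_ /= [_ ->]].
rewrite -esumZl//; last first.
  by move=> w; rewrite -EFinM lee_fin mulr_ge0// divr_ge0// ltW.
apply: eq_esum => w _; rewrite -!EFinM /walk_intensity; congr EFin.
ring.
Qed.

End Walks.

(** * The coupling of the lengths *)

(** The parameters [p1] and [p2] are the probabilities of one more step at [T1]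
    and at [T2], and [c] stands for [2d u]. *)
Section SplitWeights.
Variables (R : realType) (c p1 p2 : R).
Hypotheses (c_ge0 : 0 <= c) (p1_gt0 : 0 < p1) (p12 : p1 < p2) (p2_lt1 : p2 < 1).
Hypothesis pq : p1 * (1 - p1) <= p2 * (1 - p2).

(** Up to the factor [(1 - p2) / (1 - p1)], the law of the number of steps to be
    added to a variable of law proportional to [p1 ^+ j] so that the sum has
    a law proportional to [p2 ^+ k] ([sum_extension_prefix]). *)
Definition extension_weight (m : nat) : R :=
  if m is m'.+1 then (p2 - p1) * p2 ^+ m' else 1.

(** Weight, up to the factor [(2d)^-(j + m)], of a walk of length [j + m] whose
    prefix of length [j] belongs to the first family. The case [j = 0] is what
    remains of the intensity at [T2]: it corresponds to walks without counterpart
    in the first family, and it is nonnegative because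
    [p1 (1 - p1) <= p2 (1 - p2)]. *)
Definition split_weight (j m : nat) : R :=
  if j is _.+1 then c * (1 - p1) * (1 - p2) * p1 ^+ j * extension_weight m
  else if m is m'.+1 then
    c * (1 - p2) * p2 ^+ m' * (p2 * (1 - p2) - p1 * (1 - p1))
  else c * (1 - p2) ^+ 2.

Lemma extension_weight_ge0 m : 0 <= extension_weight m.
Proof.
case: m => [|m] //=; rewrite mulr_ge0 ?subr_ge0 ?exprn_ge0//; first exact: ltW.
by rewrite ltW// (lt_trans p1_gt0).
Qed.

Lemma split_weight_ge0 j m : 0 <= split_weight j m.
Proof.
have p1_ge0 := ltW p1_gt0.
have p2_ge0 : 0 <= p2 by rewrite ltW// (lt_trans p1_gt0).
have q2 : 0 <= 1 - p2 by rewrite subr_ge0 ltW.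
have q1 : 0 <= 1 - p1 by rewrite subr_ge0 ltW// (lt_trans p12).
case: j m => [|j] m; last first.
  rewrite /split_weight mulr_ge0 ?extension_weight_ge0//.
  by rewrite !mulr_ge0// exprn_ge0.
case: m => [|m] /=; first by rewrite mulr_ge0// exprn_ge0.
by rewrite !mulr_ge0 ?exprn_ge0// subr_ge0.
Qed.

Lemma sum_extension_prefix k :
  \sum_(j < k.+1) p1 ^+ j * extension_weight (k - j) = p2 ^+ k.
Proof.
elim: k => [|k IH]; first by rewrite big_ord1 !expr0 mul1r.
rewrite big_ord_recl /= expr0 mul1r.
under eq_bigr do rewrite /bump /= add1n subSS exprS -mulrA.
by rewrite -mulr_sumr IH exprS mulrBl subrK.
Qed.

(** Summing over all the prefixes of a walk of length [k]. *)
Lemma sum_split_weight_long k :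
  \sum_(j < k.+1) split_weight j (k - j) = c * (1 - p2) ^+ 2 * p2 ^+ k.
Proof.
case: k => [|k]; first by rewrite big_ord1 /= expr0 mulr1.
rewrite big_ord_recl subn0 (eq_bigr (fun j : 'I_k.+1 =>
  c * (1 - p1) * (1 - p2) * p1 * (p1 ^+ j * extension_weight (k - j)))).
  by rewrite -mulr_sumr sum_extension_prefix /= (exprS p2 k); ring.
by move=> j _; rewrite lift0 subSS /split_weight (exprS p1 j); ring.
Qed.

(** Summing over all the extensions of a walk of length [j.+1]. *)
Lemma sum_split_weight_short j :
  (\sum_(m <oo) (split_weight j.+1 m)%:E =
   (c * (1 - p1) ^+ 2 * p1 ^+ j.+1)%:E)%E.
Proof.
have q2 : 1 - p2 != 0 by rewrite subr_eq0 gt_eqF.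
have partial n : \sum_(0 <= m < n.+1) extension_weight m =
    (1 - p1) / (1 - p2) - (p2 - p1) / (1 - p2) * p2 ^+ n.
  elim: n => [|n IH]; first by rewrite big_nat1 /= expr0; field.
  by rewrite big_nat_recr//= IH exprS; field.
apply/cvg_lim => //; rewrite -(cvg_shiftS).
under eq_fun do rewrite sumEFin -mulr_sumr partial.
apply: cvg_EFin; first exact: nearW.
have -> : c * (1 - p1) ^+ 2 * p1 ^+ j.+1 =
    c * (1 - p1) * (1 - p2) * p1 ^+ j.+1 *
    ((1 - p1) / (1 - p2) - (p2 - p1) / (1 - p2) * 0) by field.
apply: cvgMr; apply: cvgB; first exact: cvg_cst.
apply: cvgMr; apply: cvg_expr.
by rewrite ger0_norm// ltW// (lt_trans p1_gt0).
Qed.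

End SplitWeights.

(** * The coupled families of walks *)

Section Coupling.
Variables (R : realType) (d : nat).
Hypothesis d_gt0 : (0 < d)%N.
Variables (c p1 p2 : R).
Hypotheses (c_ge0 : 0 <= c) (p1_gt0 : 0 < p1) (p12 : p1 < p2) (p2_lt1 : p2 < 1).
Hypothesis pq : p1 * (1 - p1) <= p2 * (1 - p2).
Local Notation nn := (@nearest_neighbor d).
Local Notation step := ((2 * d)%:R^-1 : R).

(** [inr (x, s, v)] is the walk [s ++ v] from [x] with its prefix [s], and
    [inl x] is a trivial walk of the first family. *)
Definition coupling_index : countType :=
  (lattice d + lattice d * seq (lattice d) * seq (lattice d))%type.

(** The walk with starting point [x] and next sites [s], if it is a
    nearest-neighbor path. *)
Definition mk_walk (x : lattice d) (s : seq (lattice d)) : option (walk d) :=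
  insub (x, s).

(** The walk of the first family. Nothing is kept when [s] is empty, nor when
    [s ++ v] is not a path; in the latter case the index has weight zero. *)
Definition short_walk (i : coupling_index) : option (walk d) :=
  match i with
  | inl x => mk_walk x [::]
  | inr (x, s, v) =>
      if (s != [::]) && path nn x (s ++ v) then mk_walk x s else None
  end.

(** The walk of the second family. *)
Definition long_walk (i : coupling_index) : option (walk d) :=
  if i is inr (x, s, v) then mk_walk x (s ++ v) else None.

(** The trivial walks of the first family are put in separately: in the second
    one the trivial walks have a smaller intensity. *)
Definition coupling_weight (i : coupling_index) : R :=
  match i with
  | inl _ => c * (1 - p1) ^+ 2
  | inr (x, s, v) => if path nn x (s ++ v) then
       step ^+ (size s + size v) * split_weight c p1 p2 (size s) (size v) else 0
  end.

Let step_ge0 : 0 <= step. Proof. by rewrite invr_ge0. Qed.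

Lemma coupling_weight_ge0 i : 0 <= coupling_weight i.
Proof.
case: i => [x|[[x s] v]] /=.
  by rewrite mulr_ge0// exprn_ge0// subr_ge0 ltW// (lt_trans p12).
case: ifP => // _; rewrite mulr_ge0 ?exprn_ge0//.
exact: split_weight_ge0.
Qed.

Lemma mk_walkP x s (w : walk d) : mk_walk x s = Some w <-> val w = (x, s).
Proof.
rewrite /mk_walk; split => [|xs].
  by case: insubP => // w' _ <- [<-].
by rewrite -xs valK.
Qed.

Lemma walk_pathP (w : walk d) : path nn (val w).1 (val w).2.
Proof. exact: (valP w). Qed.

Lemma long_walk_fiber (w : walk d) :
  \esum_(i in [set i | long_walk i = Some w]) (coupling_weight i)%:E =
  (c * (1 - p2) ^+ 2 * p2 ^+ walk_length w * step ^+ walk_length w)%:E.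
Proof.
rewrite /walk_length; have := walk_pathP w.
case wE : (val w) => [x t] /= xt.
have -> : [set i | long_walk i = Some w] =
    (fun j => inr (x, take j t, drop j t) : coupling_index) @` `I_(size t).+1.
  apply/seteqP; split => [[y|[[y s] v]] //= /mk_walkP|_ [j /= _ <-]] /=.
    rewrite wE => -[<- ->]; exists (size s).
      by rewrite /= ltnS size_cat leq_addr.
    by rewrite take_size_cat// drop_size_cat.
  by apply/mk_walkP; rewrite cat_take_drop.
rewrite esum_image; last first.
  move=> i j /set_mem/= it /set_mem/= jt [/(congr1 size)].
  by rewrite !size_takel//.
rewrite esum_II; last by move=> i; rewrite lee_fin coupling_weight_ge0.
rewrite sumEFin -(sum_split_weight_long c p1 p2) mulrC mulr_sumr; congr EFin.
apply: eq_bigr => j _; have jt : (j <= size t)%N by rewrite -ltnS.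
by rewrite /= cat_take_drop xt size_takel// size_drop subnKC.
Qed.

Lemma short_walk_fiber (w : walk d) :
  \esum_(i in [set i | short_walk i = Some w]) (coupling_weight i)%:E =
  (c * (1 - p1) ^+ 2 * p1 ^+ walk_length w * step ^+ walk_length w)%:E.
Proof.
rewrite /walk_length; have := walk_pathP w.
case wE : (val w) => [x [|y s]] /= xs.
  have -> : [set i | short_walk i = Some w] = [set inl x].
    apply/seteqP; split => [[y|[[y s] v]] /=|_ ->]; last exact/mk_walkP.
      by move=> /mk_walkP; rewrite wE => -[->].
    case: ifP => // /andP [s0 _] /mk_walkP; rewrite wE => -[_ s0'].
    by move: s0; rewrite -s0'.
  by rewrite esum_set1 ?lee_fin ?coupling_weight_ge0//= !expr0 !mulr1.
pose z := last y s.
have -> : [set i | short_walk i = Some w] =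
   (fun v => inr (x, y :: s, v) : coupling_index) @`
     \bigcup_(m in setT) [set v | size v = m /\ path nn z v].
  apply/seteqP; split => [[x'|[[x' s'] v]] /=|_ [v [m _ [vm zv]] <-]] /=.
  - by move=> /mk_walkP; rewrite wE.
  - case: ifP => // /andP [_]; rewrite cat_path => /andP [_ zv] /mk_walkP.
    rewrite wE => -[xE sE]; exists v; last by rewrite xE sE.
    by exists (size v) => //; split => //; move: zv; rewrite -sE.
  - rewrite cat_path zv andbT.
    by move/andP: (xs) => [-> ->]; exact/mk_walkP.
rewrite esum_image; last by move=> v v' _ _ [].
rewrite esum_bigcup_disjoint; last 2 first.
- by move=> m n _ _ [v [[<- _] [<- _]]].
- by move=> v; rewrite lee_fin coupling_weight_ge0.
have w_ge0 m : 0 <= split_weight c p1 p2 (size s).+1 m.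
  exact: split_weight_ge0.
rewrite -nneseries_esumT; last first.
  by move=> m; apply: esum_ge0 => v _; rewrite lee_fin coupling_weight_ge0.
rewrite mulrC EFinM -(sum_split_weight_short c p1_gt0 p12 p2_lt1).
rewrite -nneseriesZl; last first.
  by move=> m _; rewrite lee_fin.
apply: eq_eseriesr => m _.
rewrite -EFinM -[RHS]mule1 -[X in (_ * X)%E](esum_paths R d_gt0 z m).
rewrite -esumZl; last 2 first.
- by rewrite mulr_ge0// exprn_ge0.
- by move=> v; rewrite lee_fin exprn_ge0.
apply: eq_esum => v [<- zv]; rewrite -EFinM; congr EFin.
rewrite /coupling_weight cat_path /= -/z zv andbT xs exprD exprS.
ring.
Qed.

End Coupling.

Lemma point_count_gt0 (R : realType) (E : choiceType) (m : E -> nat)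
    (A : set E) :
  (0 < point_count R m A)%E <-> exists2 i, A i & (0 < m i)%N.
Proof.
split => [m0|[i Ai mi]].
  apply: contrapT => nA; move: m0; rewrite /point_count esum1 ?ltxx// => i Ai.
  by case: (posnP (m i)) => [->//|mi]; exfalso; apply: nA; exists i.
apply: (@lt_le_trans _ _ (m i)%:R%:E); first by rewrite lte_fin ltr0n.
apply: esum_ge; exists [set i]; last by rewrite fsbig_set1.
by split; [exact: finite_set1|move=> j ->].
Qed.

(** * Domination of the open edges *)

Section OpenEdges.
Variable d : nat.

Lemma measurable_open (e : lattice_edges d) :
  measurable [set eta : config d | eta e].
Proof. by apply: sub_sigma_algebra; exists e. Qed.

Lemma measurable_open_edges (dO : measure_display) (O : measurableType dO)
    (X : O -> walk d -> nat) : (forall w, measurable_fun setT (X ^~ w)) ->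
  measurable_fun setT (fun o => open_edges (X o)).
Proof.
move=> mX.
apply: (@measurability _ _ _ (config d) setT _ (@open_events d) erefl).
move=> _ [_ [e _ <-] <-].
rewrite setTI.
have -> : (fun o => open_edges (X o)) @^-1` [set eta | eta e] =
    \bigcup_n oapp (fun w : walk d => if val e \in walk_edges w then
      [set o | (0 < X o w)%N] else set0) set0 (choice.pickle_inv n).
  apply/seteqP; split => o /=.
    move=> /asboolP [w [Xw ew]]; exists (choice.pickle w) => //.
    by rewrite choice.pickleK_inv /= ew.
  move=> [n _]; case: choice.pickle_inv => [w|]//=; case: ifP => // ew Xw.
  by apply/asboolP; exists w.
apply: bigcupT_measurable => n.
case: choice.pickle_inv => [w|]//=; case: ifP => // _.
have := mX w measurableT [set k | (0 < k)%N] I.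
by rewrite setTI.
Qed.

End OpenEdges.

Lemma FI_law_pushforward (R : realType) (d : nat) (u T : R) (dO : measure_display)
    (O : measurableType dO) (P : probability O R) (X : O -> walk d -> nat)
    (nu : set (config d) -> \bar R) :
  Poisson_point_process P (FI_intensity u T) X ->
  (forall A, nu A = P [set o | A (open_edges (X o))]) -> FI_law u T nu.
Proof. by move=> PX nuE; exists dO, O, P, X; split. Qed.

(** Every nontrivial short walk that occurs is a prefix of a long walk that
    occurs. *)
Lemma open_edges_dominated (R : realType) (d : nat)
    (M : coupling_index d -> nat) (m1 m2 : walk d -> nat) :
  (forall w, (m1 w)%:R%:E = point_count R M [set i | short_walk i = Some w]) ->
  (forall w, (m2 w)%:R%:E = point_count R M [set i | long_walk i = Some w]) ->
  forall e : lattice_edges d, (open_edges m1 e <= open_edges m2 e)%N.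
Proof.
move=> m1E m2E e; case: (boolP (open_edges m1 e)) => // /asboolP [w [m1w ew]].
suff -> : open_edges m2 e by [].
have : (0 < ((m1 w)%:R : R)%:E)%E by rewrite lte_fin ltr0n.
rewrite m1E => /point_count_gt0 [[x|[[x s] v]] /=].
  by move=> /mk_walkP wE; move: ew; rewrite /walk_edges wE.
case: ifP => // /andP [s0 xsv] /mk_walkP wE Mi.
pose w2 : walk d := Sub (x, s ++ v) xsv.
apply/asboolP; exists w2; split.
  rewrite -(ltr0n R) -lte_fin m2E; apply/point_count_gt0.
  exists (inr (x, s, v)) => //=; apply/mk_walkP.
  by rewrite /w2 SubK.
move: ew; rewrite /walk_edges /w2 wE SubK /= pairmap_cat mem_cat.
by move=> ->.
Qed.

Lemma FI_intensity_pre (R : realType) (d : nat) (u T : R) (E : choiceType)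
    (lam : E -> R) (f : E -> option (walk d)) :
  (0 < d)%N -> 0 <= u -> 0 < T -> (forall i, 0 <= lam i) ->
  (forall w, \esum_(i in [set i | f i = Some w]) (lam i)%:E =
     (walk_intensity d u T (walk_length w))%:E) ->
  forall A, FI_intensity u T A =
    \esum_(i in [set i | exists2 w, A w & f i = Some w]) (lam i)%:E.
Proof.
move=> d0 u0 T0 lam0 fib A; rewrite FI_intensityE//.
have -> : [set i | exists2 w, A w & f i = Some w] =
    \bigcup_(w in A) [set i | f i = Some w].
  by apply/seteqP; split => i [w Aw fw]; exists w.
rewrite esum_bigcup_disjoint//; first by apply: eq_esum => w _; rewrite fib.
by move=> w v _ _ [i [/= -> [->]]].
Qed.

Lemma FI_intensity_set1_lty (R : realType) (d : nat) (u T : R) (w : walk d) :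
  (0 < d)%N -> 0 <= u -> 0 < T -> (0 <= FI_intensity u T [set w] < +oo)%E.
Proof.
move=> d0 u0 T0; have T1 : 0 <= T + 1 by rewrite addr_ge0// ltW.
have w0 : 0 <= walk_intensity d u T (walk_length w).
  by rewrite /walk_intensity !mulr_ge0 ?exprn_ge0 ?divr_ge0 ?invr_ge0// ltW.
by rewrite FI_intensityE// esum_set1 ?ltry ?andbT ?lee_fin.
Qed.

(** The hypothesis [T1 * T2 <= 1] gives the fourth inequality: the rate of
    nontrivial walks increases from [T1] to [T2]. *)
Lemma step_probability_facts (R : realType) (T1 T2 : R) :
  0 < T1 -> T1 < T2 -> T1 * T2 <= 1 ->
  let p T := T / (T + 1) in
  [/\ 0 < p T1, p T1 < p T2, p T2 < 1,
      p T1 * (1 - p T1) <= p T2 * (1 - p T2) &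
      forall T, 0 < T -> 1 - p T = (T + 1)^-1].
Proof.
move=> T1_gt0 T12 T1T2 p.
have T2_gt0 : 0 < T2 by apply: lt_trans T12.
have qE T : 0 < T -> 1 - p T = (T + 1)^-1.
  by move=> T0; rewrite /p; field; rewrite gt_eqF// addr_gt0.
split => //.
- by rewrite divr_gt0// addr_gt0.
- rewrite ltr_pdivrMr ?addr_gt0// mulrAC ltr_pdivlMr ?addr_gt0//.
  nra.
- by rewrite -subr_gt0 qE// invr_gt0 addr_gt0.
- rewrite !qE// /p -!mulrA -!invfM.
  rewrite ler_pdivrMr ?mulr_gt0 ?addr_gt0// mulrAC.
  rewrite ler_pdivlMr ?mulr_gt0 ?addr_gt0//.
  nra.
Qed.

Theorem theorem1 (R : realType) (d : nat) (hd : (3 <= d)%N) (u T1 T2 : R)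
    (hu : 0 < u) (hT1 : 0 < T1) (hT12 : T1 < T2) (hT : T1 * T2 <= 1) :
  exists Q : probability (config d * config d)%type R,
    [/\ FI_law u T1 (pushforward Q fst),
        FI_law u T2 (pushforward Q snd)
      & {ae Q, forall eta : config d * config d,
           forall e : lattice_edges d, (eta.1 e <= eta.2 e)%N}].
Proof.
have d_gt0 : (0 < d)%N by apply: leq_trans hd.
have T2_gt0 : 0 < T2 by apply: lt_trans hT12.
have u_ge0 := ltW hu.
have [] := step_probability_facts hT1 hT12 hT.
move=> /= p1_gt0 p12 p2_lt1 pq qE.
pose p T : R := T / (T + 1).
pose c : R := (2 * d)%:R * u.
have c_ge0 : 0 <= c by rewrite mulr_ge0.
have lam_ge0 := coupling_weight_ge0 (d := d) c_ge0 p1_gt0 p12 p2_lt1 pq.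
have [dO [Om [P [M PM]]]] := exists_Poisson_point_process lam_ge0.
have fib1 (w : walk d) : \esum_(i in [set i | short_walk i = Some w])
    (coupling_weight c (p T1) (p T2) i)%:E =
    (walk_intensity d u T1 (walk_length w))%:E.
  by rewrite (short_walk_fiber d_gt0 c_ge0 p1_gt0 p12 p2_lt1 pq) qE.
have muE1 := FI_intensity_pre d_gt0 u_ge0 hT1 lam_ge0 fib1.
have fib2 (w : walk d) : \esum_(i in [set i | long_walk i = Some w])
    (coupling_weight c (p T1) (p T2) i)%:E =
    (walk_intensity d u T2 (walk_length w))%:E.
  by rewrite (long_walk_fiber c_ge0 p1_gt0 p12 p2_lt1 pq) qE.
have muE2 := FI_intensity_pre d_gt0 u_ge0 T2_gt0 lam_ge0 fib2.
have fin1 w := FI_intensity_set1_lty w d_gt0 u_ge0 hT1.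
have fin2 w := FI_intensity_set1_lty w d_gt0 u_ge0 T2_gt0.
have [X1 [PX1 X1E]] : exists X : Om -> walk d -> nat,
    Poisson_point_process P (FI_intensity u T1) X /\
    {ae P, forall o, forall w, (X o w)%:R%:E =
       point_count R (M o) [set i | short_walk i = Some w]}.
  by apply: (Poisson_point_process_map PM) => // w; rewrite -muE1.
have [X2 [PX2 X2E]] : exists X : Om -> walk d -> nat,
    Poisson_point_process P (FI_intensity u T2) X /\
    {ae P, forall o, forall w, (X o w)%:R%:E =
       point_count R (M o) [set i | long_walk i = Some w]}.
  by apply: (Poisson_point_process_map PM) => // w; rewrite -muE2.
have mX1 : measurable_fun setT (fun o => open_edges (X1 o)).
  by apply: measurable_open_edges; case: PX1.
have mX2 : measurable_fun setT (fun o => open_edges (X2 o)).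
  by apply: measurable_open_edges; case: PX2.
pose g o := (open_edges (X1 o), open_edges (X2 o)) : config d * config d.
have mg : measurable_fun setT g by exact: measurable_fun_pair.
pose Q : probability (config d * config d)%type R :=
  distribution P (mfun_Sub (mem_set mg)).
have QE A : Q A = P (g @^-1` A) by [].
exists Q; split.
- by apply: (FI_law_pushforward PX1) => A.
- by apply: (FI_law_pushforward PX2) => A.
have dom : {ae P, forall o, forall e : lattice_edges d,
    ((g o).1 e <= (g o).2 e)%N}.
  by apply: filterS2 X1E X2E => o; exact: open_edges_dominated.
have : {ae Q, forall eta : config d * config d, forall n,
    oapp (fun e : lattice_edges d => (eta.1 e <= eta.2 e)%N) true
      (@choice.pickle_inv (lattice_edges d) n)}.
  apply/ae_foralln => n; case: choice.pickle_inv => [e|]; last exact: aeW.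
  (* the pairs of configurations violating the domination at [e] *)
  pose B : set (config d * config d) :=
    (fst @^-1` [set eta : config d | eta e]) `&`
    (snd @^-1` (~` [set eta : config d | eta e])).
  have mB : measurable B.
    apply: measurableI; rewrite -[X in measurable X]setTI.
      by apply: measurable_fst => //; exact: measurable_open.
    by apply: measurable_snd => //; apply: measurableC; exact: measurable_open.
  exists B; split => //.
    apply: etrans (QE B) _; rewrite -(measure0 P).
    apply: probability_ae_eq => //.
      by have := mg measurableT _ mB; rewrite setTI.
    apply: filterS dom => o /(_ e); rewrite /B /=.
    by do 2![case: (open_edges _ _) => //]; split => // -[].
  move=> eta /=; rewrite /B /=; case: (eta.1 e) => //; case: (eta.2 e) => //= _.
apply: filterS => eta H e.
by have := H (choice.pickle e); rewrite choice.pickleK_inv.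
Qed.
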